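(* Let $c,d\ge1$ be integers, let $\mathcal G$ be an invertible hermitian $(c+d)\times(c+d)$ matrix of signature $(c,d)$ (i.e. with $c$ positive and $d$ negative eigenvalues), and let $\mathbb G=\{\mathcal T\in\mathrm{Mat}(c+d,\mathbb C):\mathcal T^*\mathcal G\mathcal T=\mathcal G\}$. Then there exists an invertible matrix $\mathcal B\in \mathrm{GL}(c+d,\mathbb C)$ such that for every probability space $(\mathbb X,\mathfrak A,\mu)$, every measure-preserving map $f:\mathbb X\to\mathbb X$ and every measurable map $\mathcal A:\mathbb X\to\mathbb G$ for which $x\mapsto\ln\|\mathcal A(x)\|$ is $\mu$-integrable, one has $$\int_0^1 L^d\big(f,\mathcal B^{-1}\mathcal U^{(c,d)}_\theta\mathcal B\,\mathcal A\big)\,d\theta\,=\,\int_{\mathbb X}N_d\big(\mathcal B\,\mathcal A(x)\,\mathcal B^{-1}\big)\,d\mu(x),$$ where $\mathcal B^{-1}\mathcal U^{(c,d)}_\theta\mathcal B\,\mathcal A$ denotes the map $x\mapsto \mathcal B^{-1}\mathcal U^{(c,d)}_\theta\mathcal B\,\mathcal A(x)$.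
   Context: For $\theta\in[0,1]$, $\mathcal U^{(c,d)}_\theta=\begin{pmatrix}e^{2\pi i\theta}\mathbf 1_c&0\\0&\mathbf 1_d\end{pmatrix}$, where $\mathbf 1_k$ is the $k\times k$ identity matrix. $f$ measure-preserving means $\int_{\mathbb X} g(f(x))\,d\mu(x)=\int_{\mathbb X} g(x)\,d\mu(x)$ for all $g\in L^1(d\mu)$ (not necessarily invertible). $\|\cdot\|$ is the operator norm, and $\sigma_1(\mathcal T)\ge\sigma_2(\mathcal T)\ge\dots$ are the singular values of a matrix $\mathcal T$. For a measurable invertible-matrix-valued map $\mathcal A$ on $\mathbb X$ with suitable log-integrability, put $\mathcal A_n(x)=\mathcal A(f^{n-1}(x))\cdots\mathcal A(f(x))\mathcal A(x)$. The Lyapunov exponents are $L_k(f,\mathcal A)=\lim_{n\to\infty}\frac1n\int_{\mathbb X}\ln\sigma_k(\mathcal A_n(x))\,d\mu(x)$, and $L^k(f,\mathcal A)=\sum_{j=1}^k L_j(f,\mathcal A)=\lim_{n\to\infty}\frac1n\int_{\mathbb X}\ln\|\Lambda^k\mathcal A_n(x)\|\,d\mu(x)$, where $\Lambda^k$ is the $k$-th exterior power. (For $\mathcal A$ with values in $\mathbb G$ and $\ln\|\mathcal A(\cdot)\|\in L^1(d\mu)$ these limits exist.) For $\mathcal T\in \mathrm{GL}(m,\mathbb C)$ and $1\le r\le m$, $N_r(\mathcal T)=\sum_{i=1}^r\ln\left(\frac{\sigma_i(\mathcal T)+\sigma_i(\mathcal T)^{-1}}{2}\right)$. *)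

(* Defs.v *)
From HB Require Import structures.
From mathcomp Require Import all_boot all_order all_algebra complex.
From mathcomp Require Import all_classical all_reals all_analysis.

Set Implicit Arguments.
Unset Strict Implicit.
Unset Printing Implicit Defensive.

Import Order.TTheory GRing.Theory Num.Theory.
Import numFieldNormedType.Exports.

Local Open Scope classical_set_scope.
Local Open Scope ring_scope.
Local Open Scope complex_scope.
Local Open Scope sesquilinear_scope.

Section Matrices.
Context {R : realType}.
Local Notation C := R[i].

(* The roots of the characteristic polynomial, listed with multiplicity in an
   unspecified order. *)
Definition eigenvalues n (M : 'M[C]_n) : seq C :=
  sval (closed_field_poly_normal (char_poly M)).

Definition has_signature n (c d : nat) (G : 'M[C]_n) : Prop :=
  count (fun z : C => 0 < z) (eigenvalues G) = c /\
  count (fun z : C => z < 0) (eigenvalues G) = d.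

Definition pseudo_unitary n (G : 'M[C]_n) : set 'M[C]_n :=
  [set T | T ^t* *m G *m T = G].

Definition expi2pi (theta : R) : C :=
  cos (2 * pi * theta) +i* sin (2 * pi * theta).

Definition Umx (c d : nat) (theta : R) : 'M[C]_(c + d) :=
  block_mx (expi2pi theta)%:M 0 0 1%:M.

Definition l2norm n (v : 'cV[C]_n) : R :=
  Num.sqrt (\sum_i (complex.Re `|v i 0|) ^+ 2).

Definition opnorm n (T : 'M[C]_n) : R :=
  sup [set l2norm (T *m v) | v in [set v : 'cV[C]_n | l2norm v = 1]].

(* Square roots of the eigenvalues of T^* T, which are real and nonnegative. *)
Definition singular_values n (T : 'M[C]_n) : seq R :=
  sort >=%R [seq Num.sqrt (complex.Re z) | z <- eigenvalues (T ^t* *m T)].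

(* Indices start at 0: [singular_value T k] is sigma_{k+1}(T). *)
Definition singular_value n (T : 'M[C]_n) (k : nat) : R :=
  nth 0 (singular_values T) k.

Definition Nsum n (r : nat) (T : 'M[C]_n) : R :=
  \sum_(i < r) ln ((singular_value T i + (singular_value T i)^-1) / 2).

End Matrices.

Section Cocycles.
Context {R : realType} {disp : measure_display} {X : measurableType disp}.
Local Notation C := R[i].

Definition measure_preserving (mu : {measure set X -> \bar R}) (f : X -> X) :
    Prop :=
  measurable_fun setT f /\
  forall g : X -> R, mu.-integrable setT (EFin \o g) ->
    (\int[mu]_x (g (f x))%:E = \int[mu]_x (g x)%:E)%E.

(* Borel measurability for the topology of C^(n * n). *)
Definition measurable_mx n (A : X -> 'M[C]_n) : Prop :=
  forall i j, measurable_fun setT (fun x => complex.Re (A x i j)) /\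
              measurable_fun setT (fun x => complex.Im (A x i j)).

Fixpoint cocycle n (f : X -> X) (A : X -> 'M[C]_n) (k : nat) (x : X) :
    'M[C]_n :=
  if k is k'.+1 then A (iter k' f x) *m cocycle f A k' x else 1%:M.

(* Indices start at 0: [lyapunov mu f A k] is L_{k+1}(f, A). *)
Definition lyapunov n (mu : {measure set X -> \bar R}) (f : X -> X)
    (A : X -> 'M[C]_n) (k : nat) : \bar R :=
  lim ((((m%:R)^-1)%:E *
        \int[mu]_x (ln (singular_value (cocycle f A m x) k))%:E)%E
       @[m --> \oo]).

Definition lyapunov_sum n (mu : {measure set X -> \bar R}) (f : X -> X)
    (A : X -> 'M[C]_n) (k : nat) : \bar R :=
  (\sum_(j < k) lyapunov mu f A j)%E.

End Cocycles.

(* Main.v *)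
Require Import Defs.
(** Let J = diag(1_c, -1_d) and choose B with B^* J B = G, so that A' = B A B^-1
    takes values in U(c,d).  For M in U(c,d) with lower right d x d block D,
    N_d(M) = ln |det D|, and N_d(M) differs from ln (sigma_1 ... sigma_d)(M) by
    at most d ln 2.  Replacing e^(2 pi i theta) by z, the lower right block of
    U_z A'_n ... U_z A'_1 has a determinant polynomial in z without zeros in
    the closed unit disc, because U_z does not increase the form J there.  The
    mean of the logarithm of its modulus over the unit circle is therefore its
    value at z = 0, where the block is D_n ... D_1: for every n,
      \int_0^1 N_d(U_theta A'_n ... U_theta A'_1) dtheta = N_d(A'_1) + ... + N_d(A'_n).
    Integrating over X, dividing by n and letting n tend to infinity (Fekete's
    lemma for the limits, dominated convergence in theta) gives the theorem. *)
From HB Require Import structures.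
From mathcomp Require Import all_boot all_order fingroup perm all_algebra complex.
From mathcomp Require Import ring lra.
From mathcomp Require Import all_classical all_reals all_analysis.
From mathcomp Require Import measurable_realfun.

Set Implicit Arguments.
Unset Strict Implicit.
Unset Printing Implicit Defensive.

Import Order.TTheory GRing.Theory Num.Theory.
Import numFieldNormedType.Exports.
Import ComplexField.Normc.

Local Open Scope classical_set_scope.
Local Open Scope ring_scope.
Local Open Scope complex_scope.
Local Open Scope sesquilinear_scope.

(** * Cauchy-Binet and sums of principal minors *)

Section CauchyBinet.
Context {R : comNzRingType}.

(** The link between [N_d] and the block [D] is the inverse of the Gram matrix: for [H = M^t* M]
    with [M] in U(c,d) one has [H^-1 = J H J]. Hence [H + H^-1 + 2] is block diagonal, its
    determinant has modulus [4^(c+d) |det D|^4], and its eigenvalues are the squares of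
    [sigma_i + 1/sigma_i]. The singular values are stable under inversion and at most [min(c,d)] of
    them exceed 1, so the product of [(sigma_i + 1/sigma_i)/2] over all indices is the square of the
    product over the first [d]. The exponents are limits one by one, so the means of
    [ln (sigma_1 ... sigma_k)] divided by [n] must converge for every [k <= d], not only for
    [k = d]. Each product is compared with a sum of k x k minors, which is submultiplicative by
    Cauchy-Binet and plays the part of the norm on the k-th exterior power. This comparison, the
    conjugation by [B] and the passage from [N_d] to singular values each cost an additive constant,
    uniform in theta and in the point, which disappears after division by [n]. *)

Lemma det_mulmx_rows k n (A : 'M[R]_(k, n)) (B : 'M[R]_(n, k)) :
  \det (A *m B) =
  \sum_(f : {ffun 'I_k -> 'I_n}) (\prod_i A i (f i)) * \det (mxsub f id B).
Proof.
pose AB (s : 'S_k) i j := A i j * B j (s i).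
transitivity (\sum_(f : {ffun 'I_k -> 'I_n}) \sum_(s : 'S_k)
   (-1) ^+ s * \prod_i AB s i (f i)).
  rewrite exchange_big; apply: eq_bigr => /= s _; rewrite -big_distrr /=.
  congr (_ * _); rewrite -(bigA_distr_bigA (AB s)) /=.
  by apply: eq_bigr => x _; rewrite mxE.
apply: eq_bigr => f _; rewrite big_distrr /=; apply: eq_bigr => s _.
rewrite mulrCA big_split //=; congr (_ * (_ * _)).
by apply: eq_bigr => x _; rewrite mxE.
Qed.

Lemma mxsub_perm_rows k n p (s : 'S_k) (f : 'I_k -> 'I_n) (g : 'I_p -> 'I_p) (M : 'M[R]_(n, p)) :
  mxsub (f \o s) g M = row_perm s (mxsub f g M).
Proof. by apply/matrixP => i j; rewrite !mxE. Qed.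

(* The sum runs over all index functions instead of k-subsets, whence the k!. *)
Lemma Cauchy_Binet k n (A : 'M[R]_(k, n)) (B : 'M[R]_(n, k)) :
  \det (A *m B) *+ k`! =
  \sum_(f : {ffun 'I_k -> 'I_n}) \det (mxsub id f A) * \det (mxsub f id B).
Proof.
(* The row expansion, reindexed by [f] composed with [s]; the permuted rows of [B] produce the sign.
   Summing over all [s] then assembles the Leibniz formula for the minor of [A]. *)
have E (s : 'S_k) : \det (A *m B) = \sum_(f : {ffun 'I_k -> 'I_n})
    ((-1) ^+ s * \prod_i A i (f (s i))) * \det (mxsub f id B).
  have b : bijective (fun f : {ffun 'I_k -> 'I_n} => [ffun i => f (s i)]).
    exists (fun f : {ffun 'I_k -> 'I_n} => [ffun i => f (s^-1%g i)]) => f; apply/ffunP => i;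
    by rewrite !ffunE ?permK ?permKV.
  rewrite det_mulmx_rows (reindex _ (onW_bij _ b)) /=; apply: eq_bigr => f _.
  rewrite mxsub_ffunl mxsub_perm_rows row_permE det_mulmx det_perm.
  rewrite mulrCA mulrA; congr (_ * _ * _).
  by apply: eq_bigr => i _; rewrite ffunE.
have -> : \det (A *m B) *+ k`! = \sum_(s : 'S_k) \det (A *m B).
  by rewrite sumr_const card_Sn.
rewrite (eq_bigr _ (fun s _ => E s)) exchange_big; apply: eq_bigr => f _.
rewrite -mulr_suml; congr (_ * _).
apply: eq_bigr => s _; congr (_ * _).
by apply: eq_bigr => i _; rewrite mxE.
Qed.

(* k! times the k-th elementary symmetric function of the eigenvalues. *)
Definition minor_sum k n (M : 'M[R]_n) : R :=
  \sum_(f : {ffun 'I_k -> 'I_n}) \det (mxsub f f M).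

Lemma mxsub_mul k l m n p (f : 'I_k -> 'I_m) (g : 'I_l -> 'I_p) (A : 'M[R]_(m, n)) (B : 'M[R]_(n, p)) :
  mxsub f g (A *m B) = mxsub f id A *m mxsub id g B.
Proof. by apply/matrixP => i j; rewrite !mxE; apply: eq_bigr => l' _; rewrite !mxE. Qed.

Lemma det_minor_mul k m n p (f : 'I_k -> 'I_m) (g : 'I_k -> 'I_p) (A : 'M[R]_(m, n)) (B : 'M[R]_(n, p)) :
  \det (mxsub f g (A *m B)) *+ k`! =
  \sum_(h : {ffun 'I_k -> 'I_n}) \det (mxsub f h A) * \det (mxsub h g B).
Proof.
rewrite mxsub_mul Cauchy_Binet; apply: eq_bigr => h _.
by rewrite -!mxsub_comp.
Qed.

(** Both sides expand into the same double sum of products of minors of [A] and [B]. The factor [k!]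
    stays because it cannot be cancelled in a general commutative ring. *)
Lemma minor_sum_mulC k n (A B : 'M[R]_n) :
  minor_sum k (A *m B) *+ k`! = minor_sum k (B *m A) *+ k`!.
Proof.
rewrite -!sumrMnl; under eq_bigr do rewrite det_minor_mul.
under [RHS]eq_bigr do rewrite det_minor_mul.
rewrite exchange_big.
by apply: eq_bigr => f _; apply: eq_bigr => g _; rewrite mulrC.
Qed.

Lemma minor_sum_diag k n (r : 'rV[R]_n) :
  minor_sum k (diag_mx r) =
  \sum_(f : {ffun 'I_k -> 'I_n} | injectiveb f) \prod_i r 0 (f i).
Proof.
rewrite /minor_sum (bigID (fun f : {ffun 'I_k -> 'I_n} => injectiveb f)) /= addrC big1 ?add0r.
  apply: eq_bigr => f /injectiveP fi.
  have -> : mxsub f f (diag_mx r) = diag_mx (\row_i r 0 (f i)).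
    by apply/matrixP => i j; rewrite !mxE (inj_eq fi).
  by rewrite det_diag; apply: eq_bigr => i _; rewrite mxE.
move=> f /injectivePn[i1 [i2 Di12 Ef12]].
by rewrite (determinant_alternate Di12) // => j; rewrite !mxE Ef12.
Qed.

End CauchyBinet.

(** * Singular values *)

Section Spectral.
Context {R : realType}.
Local Notation C := R[i].

Lemma char_poly_conj (F : fieldType) n (P M : 'M[F]_n) : P \in unitmx ->
  char_poly (invmx P *m M *m P) = char_poly M.
Proof.
move=> uP; rewrite /char_poly.
have -> : char_poly_mx (invmx P *m M *m P) =
  map_mx polyC (invmx P) *m char_poly_mx M *m map_mx polyC P.
  rewrite /char_poly_mx mulmxBr mulmxBl -!map_mxM; congr (_ - _).
  by rewrite mul_mx_scalar -scalemxAl -map_mxM mulVmx // map_mx1 scalemx1.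
rewrite !det_mulmx mulrAC -det_mulmx -map_mxM mulVmx // map_mx1 det1 mul1r //.
Qed.

Lemma eigenvaluesE n (M : 'M[C]_n) :
  char_poly M = \prod_(z <- eigenvalues M) ('X - z%:P).
Proof.
rewrite /eigenvalues; case: (closed_field_poly_normal _) => s /= {1}->.
by rewrite (monicP (char_poly_monic M)) scale1r.
Qed.

Lemma eigenvalues_conj_diag n (P : 'M[C]_n) (r : 'rV[C]_n) : P \in unitmx ->
  perm_eq (eigenvalues (invmx P *m diag_mx r *m P)) [seq r 0 i | i <- enum 'I_n].
Proof.
move=> uP; apply: prod_XsubC_eq; rewrite -eigenvaluesE char_poly_conj //.
rewrite char_poly_trig ?diag_mx_is_trig // big_map big_enum.
by apply: eq_bigr => i _; rewrite mxE eqxx.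
Qed.

Lemma mulmx_adj_unitary n (P : 'M[C]_n) : P \is unitarymx ->
  P^t* *m P = 1%:M.
Proof. by move=> uP; rewrite -(invmx_unitary uP) mulVmx // unitarymx_unit. Qed.

(** A permutation matrix is absorbed into the unitary matrix, so the diagonal may follow any
    prescribed order: decreasing for Gram matrices, positive before negative for the form [G]. *)
Lemma spectral_reorder n (M : 'M[C]_n) (t : seq C) : M \is hermsymmx ->
  perm_eq t (eigenvalues M) ->
  exists2 P : 'M[C]_n, P \is unitarymx & M = P^t* *m diag_mx (\row_i t`_i) *m P.
Proof.
move=> /hermitian_normalmx/orthomx_spectralP.
set U := spectralmx M; set r := spectral_diag M => ME pt.
have uU : U \is unitarymx by exact: spectral_unitarymx.
have : perm_eq t [tuple r 0 i | i < n].
  apply: (perm_trans pt); rewrite ME /= -[enum _]/(enum 'I_n).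
  by rewrite eigenvalues_conj_diag // unitarymx_unit.
case/tuple_permP => s tE.
have st : \row_(i < n) t`_i = \row_i r 0 (s i).
  apply/rowP => i; rewrite !mxE tE (nth_map i) ?size_enum_ord //.
  by rewrite nth_ord_enum tnth_mktuple.
exists (perm_mx s *m U).
  rewrite mul_unitarymx //; apply/unitarymxP.
  by rewrite tr_perm_mx map_perm_mx -perm_mxM mulgV perm_mx1.
have rE : diag_mx r = perm_mx s^-1 *m diag_mx (\row_i r 0 (s i)) *m perm_mx s.
  rewrite -row_permE -{3}[s]invgK -col_permE; apply/matrixP => i j.
  by rewrite !mxE permKV (inj_eq perm_inj).
by rewrite st trmx_mul map_mxM tr_perm_mx map_perm_mx ME rE invmx_unitary // !mulmxA.
Qed.

Lemma size_eigenvalues n (M : 'M[C]_n) : size (eigenvalues M) = n.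
Proof.
apply/succn_inj; rewrite -(size_char_poly M) eigenvaluesE.
by rewrite size_prod_XsubC.
Qed.

Lemma gram_hermsym n (T : 'M[C]_n) : T^t* *m T \is hermsymmx.
Proof.
apply/is_hermitianmxP; rewrite expr0 scale1r trmx_mul map_mxM.
by rewrite /= trmxCK.
Qed.

Lemma gram_diag_ge0 m n (T : 'M[C]_(m, n)) i : 0 <= (T^t* *m T) i i.
Proof.
rewrite mxE sumr_ge0 // => j _; rewrite !mxE mulrC.
by rewrite mul_conjC_ge0.
Qed.

Lemma gram_eigenvalues_ge0 n (T : 'M[C]_n) (z : C) :
  z \in eigenvalues (T^t* *m T) -> 0 <= z.
Proof.
have [P uP HE] := spectral_reorder (gram_hermsym T) (perm_refl _).
move=> /(nthP 0); case=> i; rewrite size_eigenvalues => ltin <-.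
(* The i-th eigenvalue is a diagonal entry of the Gram matrix of [T P^t*]. *)
have := gram_diag_ge0 (T *m P^t*) (Ordinal ltin).
rewrite trmx_mul map_mxM trmxCK /= mulmxA -(mulmxA P) {1}HE !mulmxA.
by rewrite (unitarymxP uP) mul1mx mulmxtVK // !mxE eqxx.
Qed.

Lemma size_singular_values n (T : 'M[C]_n) : size (singular_values T) = n.
Proof. by rewrite size_sort size_map size_eigenvalues. Qed.

Lemma singular_value_ge0 n (T : 'M[C]_n) i : 0 <= singular_value T i.
Proof.
rewrite /singular_value; case: (ltnP i (size (singular_values T))) => [lti|].
  have := mem_nth 0 lti; rewrite mem_sort => /mapP[z _ ->].
  exact: sqrtr_ge0.
by move=> ?; rewrite nth_default.
Qed.

Lemma singular_value_le n (T : 'M[C]_n) i j : (i <= j)%N ->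
  singular_value T j <= singular_value T i.
Proof.
move=> ij; case: (ltnP j n) => [ltj|lej]; last first.
  rewrite {1}/singular_value nth_default ?size_singular_values //.
  exact: singular_value_ge0.
have tot : total (>=%R : rel R) by move=> x y; rewrite /= le_total.
have tr : transitive (>=%R : rel R) by move=> x y z /= xy yz; exact: le_trans xy.
apply: (sorted_leq_nth tr (@lexx _ _) 0 (sort_sorted tot _)) => //;
  by rewrite inE size_singular_values // (leq_ltn_trans ij).
Qed.

Lemma gram_singular n (T : 'M[C]_n) : exists2 P : 'M[C]_n, P \is unitarymx &
  T^t* *m T = P^t* *m diag_mx (\row_(i < n) ((singular_value T i) ^+ 2)%:C) *m P.
Proof.
have := @spectral_reorder _ _ [seq (s ^+ 2)%:C | s <- singular_values T]
  (gram_hermsym T).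
case.
  rewrite (perm_trans (perm_map _ (permEl (perm_sort _ _)))) // -map_comp.
  rewrite (_ : map _ _ = eigenvalues (T^t* *m T)) // -[RHS]map_id.
  apply/eq_in_map => z /gram_eigenvalues_ge0 z0 /=.
  have zE := RRe_real (ger0_real z0).
  by rewrite sqr_sqrtr ?zE // -ler0c zE.
move=> P uP ->; exists P => //.
congr (_ *m diag_mx _ *m _); apply/rowP => i; rewrite !mxE.
by rewrite (nth_map 0) ?size_singular_values.
Qed.

End Spectral.

Section Normc.
Context {R : realType}.
Local Notation C := R[i].

Lemma normrE_normc (z : C) : `|z| = (normc z)%:C. Proof. by case: z. Qed.

Lemma normc_ge0 (z : C) : 0 <= normc z.
Proof. by rewrite -ler0c -normrE_normc. Qed.

Lemma normc_real (x : R) : normc x%:C = `|x|.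
Proof. by rewrite /normc /= expr0n addr0 sqrtr_sqr. Qed.

Lemma natr_complex k : (k%:R : R)%:C = k%:R :> C.
Proof. exact: (rmorph_nat (real_complex R)). Qed.

Lemma ler_normc_sum (I : Type) (r : seq I) (P : pred I) (F : I -> C) :
  normc (\sum_(i <- r | P i) F i) <= \sum_(i <- r | P i) normc (F i).
Proof.
rewrite -lecR -normrE_normc rmorph_sum /=; under [leRHS]eq_bigr do rewrite -normrE_normc.
exact: ler_norm_sum.
Qed.

Lemma normc_prod (I : Type) (r : seq I) (P : pred I) (F : I -> C) :
  normc (\prod_(i <- r | P i) F i) = \prod_(i <- r | P i) normc (F i).
Proof.
apply: complexI; rewrite -normrE_normc rmorph_prod /=.
by under [RHS]eq_bigr do rewrite -normrE_normc; rewrite normr_prod.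
Qed.

Lemma conjC_normc (z : C) : z * z^* = (normc z ^+ 2)%:C.
Proof. by rewrite rmorphXn /= -normrE_normc normCK. Qed.

Lemma normc_gt0 (z : C) : (0 < normc z) = (z != 0).
Proof. by rewrite -ltcR -normrE_normc normr_gt0. Qed.

End Normc.

(** Among [k+1] distinct naturals one is at least [k]; its factor is at most [a k], and induction
    handles the others. *)
Lemma prod_injective_le (R : realDomainType) (a : nat -> R) k (f : 'I_k -> nat) :
  (forall i, 0 <= a i) -> (forall i j, (i <= j)%N -> a j <= a i) ->
  injective f -> \prod_i a (f i) <= \prod_(i < k) a i.
Proof.
move=> a0 a_le; elim: k f => [|k IH] f fi; first by rewrite !big_ord0.
have [i0 fi0] : exists i0, (k <= f i0)%N.
  apply/not_existsP => H; have {}H i : (f i < k)%N.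
    by rewrite ltnNge; apply/negP/H.
  have : injective (fun i => Ordinal (H i)) by move=> i j [] /fi.
  by move/leq_card; rewrite !card_ord ltnn.
rewrite (bigD1_ord i0) //= big_ord_recr /= mulrC ler_pM //.
- by apply: prodr_ge0.
- by apply: (IH (f \o lift i0)) => i j /fi /lift_inj.
- exact: a_le.
Qed.

(** * Products of the largest singular values and sums of minors *)

Section SingularProducts.
Context {R : realType}.
Local Notation C := R[i].

Definition singular_prod n k (T : 'M[C]_n) : R := \prod_(i < k) singular_value T i.

Lemma minor_sum_conj k n (P M : 'M[C]_n) : P \is unitarymx ->
  minor_sum k (P^t* *m M *m P) = minor_sum k M.
Proof.
move=> uP; apply/(@pmulrnI _ k`!); first exact: fact_gt0.
by rewrite minor_sum_mulC mulmxA (unitarymxP uP) mul1mx.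
Qed.

Lemma gram_singularX n (T : 'M[C]_n) : exists2 P : 'M[C]_n, P \is unitarymx &
  forall m, (T^t* *m T) ^+ m =
  P^t* *m diag_mx (\row_(i < n) ((singular_value T i) ^+ (2 * m)%N)%:C) *m P.
Proof.
have [P uP HE] := gram_singular T; exists P => //.
elim=> [|m IH].
  have -> : \row_i (singular_value T i ^+ (2 * 0))%:C = const_mx 1 :> 'rV[C]_n.
    by apply/rowP => i; rewrite !mxE muln0 expr0.
  by rewrite expr0 diag_const_mx mulmx1 (mulmx_adj_unitary uP).
rewrite exprS IH {1}HE -mulmxE !mulmxA -(mulmxA (_ *m diag_mx _)).
rewrite (unitarymxP uP) mulmx1 -(mulmxA (P^t*)); congr (_ *m _ *m _).
rewrite mulmx_diag; congr diag_mx; apply/rowP => i; rewrite !mxE.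
by rewrite -rmorphM /= mulnS exprD.
Qed.

Lemma minor_sum_gramX n k (T : 'M[C]_n) m :
  minor_sum k ((T^t* *m T) ^+ m) =
  (\sum_(f : {ffun 'I_k -> 'I_n} | injectiveb f)
     \prod_i (singular_value T (f i)) ^+ (2 * m))%:C.
Proof.
have [P uP ->] := gram_singularX T.
rewrite minor_sum_conj // minor_sum_diag rmorph_sum /=; apply: eq_bigr => f _.
by rewrite rmorph_prod; apply: eq_bigr => i _; rewrite mxE.
Qed.

(** The sum runs over injective index functions with nonnegative terms: the inclusion of the first
    [k] indices gives exactly the lower bound, and each of the at most [n^k] terms is dominated by
    that one. The [2m]-th root therefore tends to [singular_prod k T]. *)
Lemma minor_sum_gramX_bounds n k (T : 'M[C]_n) m : (k <= n)%N ->
  singular_prod k T ^+ (2 * m) <= complex.Re (minor_sum k ((T^t* *m T) ^+ m))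
  <= (n ^ k)%:R * singular_prod k T ^+ (2 * m).
Proof.
move=> kn; rewrite minor_sum_gramX /= -prodrXl.
have s0 i : 0 <= singular_value T i ^+ (2 * m).
  by rewrite exprn_ge0 // singular_value_ge0.
apply/andP; split.
  pose f0 : {ffun 'I_k -> 'I_n} := [ffun i => widen_ord kn i].
  have f0i : injectiveb f0.
    by apply/injectiveP => i j; rewrite !ffunE => /(congr1 val) /= /ord_inj.
  rewrite (bigD1 f0) //= -[leLHS]addr0 lerD //.
    by rewrite le_eqVlt; apply/orP; left; apply/eqP/eq_bigr => i _; rewrite ffunE.
  by apply: sumr_ge0 => f _; apply: prodr_ge0.
rewrite big_mkcond; apply: (@le_trans _ _
  (\sum_(f : {ffun 'I_k -> 'I_n}) \prod_(i < k) singular_value T i ^+ (2 * m))).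
  apply: ler_sum => f _; case: ifPn => [/injectiveP fi|_]; last exact: prodr_ge0.
  apply: (@prod_injective_le _ (fun i => singular_value T i ^+ (2 * m)) _ (fun i => f i)) => //.
    by move=> i j ij; rewrite lerXn2r ?nnegrE ?singular_value_ge0 ?singular_value_le.
  by move=> i j /ord_inj /fi.
by rewrite sumr_const card_ffun !card_ord mulr_natl.
Qed.

(* A substitute for the operator norm of the k-th exterior power: it is
   submultiplicative, and comparable with sigma_1 ... sigma_k. *)
Definition minor_norm n k (T : 'M[C]_n) : R :=
  \sum_(f : {ffun 'I_k -> 'I_n}) \sum_(g : {ffun 'I_k -> 'I_n})
    normc (\det (mxsub f g T)).

Lemma minor_norm_mul n k (S T : 'M[C]_n) :
  minor_norm k (S *m T) <= minor_norm k S * minor_norm k T.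
Proof.
rewrite /minor_norm mulr_suml; apply: ler_sum => f _.
apply: (@le_trans _ _ (\sum_(g : {ffun 'I_k -> 'I_n}) \sum_(h : {ffun 'I_k -> 'I_n})
   normc (\det (mxsub f h S)) * normc (\det (mxsub h g T)))).
  apply: ler_sum => g _.
  apply: (@le_trans _ _ (normc (\det (mxsub f g (S *m T)) *+ k`!))).
    by rewrite normcMn -mulr_natr ler_peMr ?normc_ge0 // ler1n fact_gt0.
  rewrite det_minor_mul; apply: (le_trans (ler_normc_sum _ _ _)).
  by apply: ler_sum => h _; rewrite normcM.
rewrite exchange_big mulr_suml; apply: ler_sum => h _.
rewrite -mulr_sumr ler_wpM2l ?normc_ge0 //.
rewrite [leRHS](bigD1 h) //= lerDl sumr_ge0 // => f' _.
by apply: sumr_ge0 => g _; exact: normc_ge0.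
Qed.

(** The squared Frobenius norm of the k-th compound matrix is the trace of the compound of the Gram
    matrix; [k!] comes from indexing minors by functions. *)
Lemma sum_normc_minor n k (T : 'M[C]_n) :
  \sum_(f : {ffun 'I_k -> 'I_n}) \sum_(g : {ffun 'I_k -> 'I_n})
    normc (\det (mxsub g f T)) ^+ 2 =
  complex.Re (minor_sum k (T^t* *m T)) *+ k`!.
Proof.
have -> : complex.Re (minor_sum k (T^t* *m T)) *+ k`! =
   complex.Re (minor_sum k (T^t* *m T) *+ k`!).
  by rewrite (raddfMn (@complex.Re R)).
rewrite -sumrMnl raddf_sum; apply: eq_bigr => f _.
rewrite det_minor_mul raddf_sum; apply: eq_bigr => g _.
have -> : mxsub f g (T^t*) = map_mx Num.conj (mxsub g f T)^T.
  by apply/matrixP => i j; rewrite !mxE.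
by rewrite det_map_mx det_tr mulrC conjC_normc.
Qed.

(** With [E] the sum of principal minors of the Gram matrix, the lower bound holds because a sum of
    squares of nonnegative numbers is at most the square of their sum. For the upper bound each
    minor has square at most [k! E], hence is at most [k! n^k] times the product; this is wasteful
    but avoids a square root. There are [(n^k)^2] minors. *)
Lemma minor_norm_bounds n k (T : 'M[C]_n) : (k <= n)%N ->
  singular_prod k T <= minor_norm k T
  <= ((n ^ k) ^ 2 * k`! * n ^ k)%:R * singular_prod k T.
Proof.
move=> kn; have := minor_sum_gramX_bounds T 1 kn.
rewrite expr1 muln1; set E := complex.Re _ => /andP[E_ge E_le].
have P0 : 0 <= singular_prod k T.
  by apply: prodr_ge0 => i _; exact: singular_value_ge0.
have h0 : 0 <= minor_norm k T.
  by apply: sumr_ge0 => f _; apply: sumr_ge0 => g _; exact: normc_ge0.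
have sE := sum_normc_minor k T; rewrite -/E in sE.
have N1 : (0 < k`! * n ^ k)%N.
  rewrite muln_gt0 fact_gt0 expn_gt0.
  by case: (k) kn => [|k']; rewrite ?orbT // => /ltn_predK <-.
have det_le (f g : {ffun 'I_k -> 'I_n}) :
    normc (\det (mxsub f g T)) <= (k`! * n ^ k)%:R * singular_prod k T.
  rewrite -(@ler_pXn2r _ 2) ?nnegrE ?normc_ge0 ?mulr_ge0 //.
  apply: (@le_trans _ _ (E *+ k`!)).
    rewrite -sE exchange_big (bigD1 f) //= (bigD1 g) //=.
    rewrite -addrA lerDl addr_ge0 //.
      by apply: sumr_ge0 => ? _; rewrite sqr_ge0.
    by apply: sumr_ge0 => ? _; apply: sumr_ge0 => ? _; rewrite sqr_ge0.
  rewrite -[E *+ _]mulr_natl exprMn.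
  apply: (@le_trans _ _ (k`!%:R * ((n ^ k)%:R * singular_prod k T ^+ 2))).
    by rewrite ler_wpM2l.
  rewrite mulrA -natrM ler_wpM2r ?sqr_ge0 // -natrX ler_nat.
  by rewrite -[leqLHS]muln1 -mulnn leq_mul2l N1 orbT.
apply/andP; split.
  rewrite -(@ler_pXn2r _ 2) ?nnegrE //; apply: (le_trans E_ge).
  apply: (@le_trans _ _ (E *+ k`!)).
    rewrite -mulr_natr ler_peMr ?ler1n ?fact_gt0 //.
    by apply: le_trans E_ge; rewrite sqr_ge0.
  rewrite -sE exchange_big /minor_norm.
  rewrite expr2 mulr_suml; apply: ler_sum => f _.
  rewrite mulr_suml; apply: ler_sum => g _.
  rewrite expr2 ler_wpM2l ?normc_ge0 //.
  rewrite (bigD1 f) //= (bigD1 g) //= -addrA lerDl addr_ge0 //.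
    by apply: sumr_ge0 => ? _; rewrite normc_ge0.
  by apply: sumr_ge0 => ? _; apply: sumr_ge0 => ? _; rewrite normc_ge0.
apply: (@le_trans _ _ (\sum_(f : {ffun 'I_k -> 'I_n})
  \sum_(g : {ffun 'I_k -> 'I_n}) (k`! * n ^ k)%:R * singular_prod k T)).
  by apply: ler_sum => f _; apply: ler_sum => g _; exact: det_le.
rewrite !sumr_const card_ffun !card_ord -mulrnA -[leLHS]mulr_natl mulrA -natrM.
by rewrite mulnn mulnA.
Qed.

Lemma minor_norm_le n k (T : 'M[C]_n) (b : R) :
  (forall i j, normc (T i j) <= b) ->
  minor_norm k T <= ((n ^ k) ^ 2 * k`!)%:R * b ^+ k.
Proof.
move=> Tb.
have det_le (f g : {ffun 'I_k -> 'I_n}) : normc (\det (mxsub f g T)) <= k`!%:R * b ^+ k.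
  rewrite /determinant; apply: (le_trans (ler_normc_sum _ _ _)).
  apply: (@le_trans _ _ (\sum_(s : 'S_k) b ^+ k)); last first.
    by rewrite sumr_const card_Sn mulr_natl.
  apply: ler_sum => s _; rewrite normcM.
  have -> : normc ((-1) ^+ s : C) = 1.
    apply: complexI; rewrite -normrE_normc normrX normrN1 expr1n //.
  rewrite mul1r normc_prod -[k in b ^+ k]card_ord -prodr_const.
  by apply: ler_prod => i _; rewrite normc_ge0 mxE /=.
apply: (@le_trans _ _ (\sum_(f : {ffun 'I_k -> 'I_n})
  \sum_(g : {ffun 'I_k -> 'I_n}) k`!%:R * b ^+ k)).
  by apply: ler_sum => f _; apply: ler_sum => g _; exact: det_le.
by rewrite !sumr_const card_ffun !card_ord -mulrnA mulnn -[leLHS]mulr_natl mulrA natrM.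
Qed.

End SingularProducts.

(** * Logarithms of products of singular values *)

Section LogSingular.
Context {R : realType}.
Local Notation C := R[i].

Definition ln_sigma n k (T : 'M[C]_n) : R := \sum_(i < k) ln (singular_value T i).

Lemma singular_prod_det n (T : 'M[C]_n) : singular_prod n T = normc (\det T).
Proof.
have P0 : 0 <= singular_prod n T.
  by apply: prodr_ge0 => i _; exact: singular_value_ge0.
apply/eqP; rewrite -(@eqrXn2 _ 2) ?normc_ge0 //; apply/eqP/complexI.
rewrite -conjC_normc; have [P uP /(congr1 determinant)] := gram_singular T.
rewrite !det_mulmx det_diag det_map_mx det_tr mulrC => ->.
rewrite mulrAC -det_mulmx (mulmx_adj_unitary uP) det1 mul1r -prodrXl rmorph_prod.
by apply: eq_bigr => i _; rewrite mxE.
Qed.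

Lemma singular_value_gt0 n (T : 'M[C]_n) i : T \in unitmx -> (i < n)%N ->
  0 < singular_value T i.
Proof.
rewrite unitmxE unitfE => uT ltin; rewrite lt_neqAle singular_value_ge0 andbT.
move: uT; rewrite -normc_gt0 -singular_prod_det; apply: contraTneq => s0.
by rewrite /singular_prod (bigD1 (Ordinal ltin)) //= -s0 mul0r ltxx.
Qed.

Lemma singular_prod_gt0 n k (T : 'M[C]_n) : T \in unitmx -> (k <= n)%N ->
  0 < singular_prod k T.
Proof.
move=> uT kn; apply: prodr_gt0 => i _; apply: singular_value_gt0 => //.
exact: leq_trans (ltn_ord i) kn.
Qed.

Lemma ln_prod (I : Type) (r : seq I) (P : pred I) (F : I -> R) :
  (forall i, P i -> 0 < F i) ->
  ln (\prod_(i <- r | P i) F i) = \sum_(i <- r | P i) ln (F i).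
Proof.
move=> F0; elim: r => [|i r IH]; first by rewrite !big_nil ln1.
rewrite !big_cons; case: ifP => // Pi.
by rewrite lnM ?posrE ?F0 ?prodr_gt0 // IH.
Qed.

Lemma ln_singular_prod n k (T : 'M[C]_n) : T \in unitmx -> (k <= n)%N ->
  ln (singular_prod k T) = ln_sigma k T.
Proof.
move=> uT kn; rewrite ln_prod // => i _; apply: singular_value_gt0 => //.
exact: leq_trans (ltn_ord i) kn.
Qed.

Definition minor_const n k : nat := ((n ^ k) ^ 2 * k`! * n ^ k)%N.

Lemma minor_const_gt0 n k : (k <= n)%N -> (0 < minor_const n k)%N.
Proof.
move=> kn; have nk : (0 < n ^ k)%N.
  by rewrite expn_gt0; case: k kn => [|k']; rewrite ?orbT // => /ltn_predK <-.
by rewrite !muln_gt0 fact_gt0 !nk.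
Qed.

Lemma ln_sigma_minor n k (T : 'M[C]_n) : T \in unitmx -> (k <= n)%N ->
  ln_sigma k T <= ln (minor_norm k T) <= ln (minor_const n k)%:R + ln_sigma k T.
Proof.
move=> uT kn; have /andP[le1 le2] := minor_norm_bounds T kn.
have P0 := singular_prod_gt0 uT kn.
have c0 : 0 < (minor_const n k)%:R :> R by rewrite ltr0n minor_const_gt0.
rewrite -ln_singular_prod //; apply/andP; split.
  by rewrite ler_ln // posrE // (lt_le_trans P0).
rewrite -lnM // ler_ln // posrE ?mulr_gt0 //.
by rewrite (lt_le_trans P0).
Qed.

(** Submultiplicativity is borrowed from [minor_norm]; each of the two factors on the right pays one
    comparison constant. *)
Lemma ln_sigma_mul n k (S T : 'M[C]_n) : S \in unitmx -> T \in unitmx -> (k <= n)%N ->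
  ln_sigma k (S *m T) <= ln_sigma k S + ln_sigma k T + 2 * ln (minor_const n k)%:R.
Proof.
move=> uS uT kn; have uST : S *m T \in unitmx by rewrite unitmx_mul uS.
have /andP[ST _] := ln_sigma_minor uST kn.
have /andP[_ S2] := ln_sigma_minor uS kn.
have /andP[_ T2] := ln_sigma_minor uT kn.
have h0 (M : 'M[C]_n) : M \in unitmx -> 0 < minor_norm k M.
  move=> uM; have /andP[le1 _] := minor_norm_bounds M kn.
  exact: lt_le_trans (singular_prod_gt0 uM kn) le1.
have : ln (minor_norm k (S *m T)) <= ln (minor_norm k S) + ln (minor_norm k T).
  by rewrite -lnM ?posrE ?h0 // ler_ln ?posrE ?mulr_gt0 ?h0 // minor_norm_mul.
move: ST S2 T2; move: (ln _%:R) (ln (minor_norm k S)) (ln (minor_norm k T)).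
move: (ln (minor_norm k _)) (ln_sigma k S) (ln_sigma k T) (ln_sigma k _).
by move=> *; lra.
Qed.

Lemma ln_sigma_le n k (T : 'M[C]_n) (b : R) : T \in unitmx -> (k <= n)%N ->
  0 < b -> (forall i j, normc (T i j) <= b) ->
  ln_sigma k T <= ln (minor_const n k)%:R + k%:R * ln b.
Proof.
move=> uT kn b0 Tb; have /andP[le1 _] := ln_sigma_minor uT kn.
have /andP[P1 _] := minor_norm_bounds T kn.
apply: (le_trans le1).
rewrite mulr_natl -lnXn // -lnM ?posrE ?exprn_gt0 ?ltr0n ?minor_const_gt0 //.
rewrite ler_ln ?posrE ?mulr_gt0 ?exprn_gt0 ?ltr0n ?minor_const_gt0 //; last first.
  exact: lt_le_trans (singular_prod_gt0 uT kn) P1.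
apply: (le_trans (minor_norm_le k Tb)).
rewrite ler_wpM2r ?exprn_ge0 ?(ltW b0) // ler_nat leq_pmulr //.
by have := minor_const_gt0 kn; rewrite !muln_gt0 => /andP[].
Qed.

(** All [n] logarithms add up to 0 and decrease. If the last one kept is nonnegative, so are all
    those kept; otherwise the discarded ones are nonpositive, and the kept sum is the opposite of
    theirs. *)
Lemma ln_sigma_ge0 n k (T : 'M[C]_n) : normc (\det T) = 1 -> (k <= n)%N ->
  0 <= ln_sigma k T.
Proof.
move=> dT kn.
have uT : T \in unitmx by rewrite unitmxE unitfE -normc_gt0 dT.
have sn : ln_sigma n T = 0 by rewrite -ln_singular_prod // singular_prod_det dT ln1.
case: k kn => [|k] kn; first by rewrite /ln_sigma big_ord0.
have [s1|s1] := leP 1 (singular_value T k).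
  apply: sumr_ge0 => i _; apply: ln_ge0; apply: (le_trans s1).
  by apply: singular_value_le; rewrite -ltnS.
have : ln_sigma n T = ln_sigma k.+1 T + \sum_(k.+1 <= i < n) ln (singular_value T i).
  by rewrite /ln_sigma -!(big_mkord xpredT (fun i => ln (singular_value T i))) -big_cat_nat.
rewrite sn => /esym/eqP; rewrite addr_eq0 => /eqP ->.
rewrite oppr_ge0 big_seq; apply: sumr_le0 => i; rewrite mem_index_iota => /andP[ki _].
by apply: ln_le0; apply: ltW; apply: le_lt_trans s1; apply: singular_value_le; exact: ltnW.
Qed.

(* The approximants are visibly measurable in the entries of T. *)
Lemma ln_sigma_cvg n k (T : 'M[C]_n) : T \in unitmx -> (k <= n)%N ->
  (fun m => ln (complex.Re (minor_sum k ((T^t* *m T) ^+ m.+1))) / (2 * m.+1)%:R)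
    @ \oo --> ln_sigma k T.
Proof.
move=> uT kn; have P0 := singular_prod_gt0 uT kn.
have nk : (0 < n ^ k)%N.
  by have := minor_const_gt0 kn; rewrite !muln_gt0 => /andP[].
have b m : ln_sigma k T <= ln (complex.Re (minor_sum k ((T^t* *m T) ^+ m.+1))) / (2 * m.+1)%:R
   <= ln_sigma k T + (ln (n ^ k)%:R / 2) / m.+1%:R.
  have m0 : 0 < (2 * m.+1)%:R :> R by rewrite ltr0n.
  have /andP[le1 le2] := minor_sum_gramX_bounds T m.+1 kn.
  rewrite ler_pdivlMr // ler_pdivrMr // -ln_singular_prod // mulr_natr -lnXn //.
  have E0 := lt_le_trans (exprn_gt0 _ P0) le1.
  apply/andP; split; first by rewrite ler_ln ?posrE ?exprn_gt0.
  apply: (@le_trans _ _ (ln ((n ^ k)%:R * singular_prod k T ^+ (2 * m.+1)))).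
    by rewrite ler_ln // posrE mulr_gt0 ?exprn_gt0 // ltr0n.
  rewrite lnM ?posrE ?exprn_gt0 ?ltr0n // mulrDl lnXn // mulr_natr addrC lerD2l.
  set L := ln _; have -> // : L / 2 / m.+1%:R * (2 * m.+1)%:R = L.
  have : m.+1%:R != 0 :> R by rewrite pnatr_eq0.
  by rewrite natrM; move: m.+1%:R => z z0; field.
apply: (@squeeze_cvgr _ _ _ _ (fun=> ln_sigma k T)
  (fun m => ln_sigma k T + (ln (n ^ k)%:R / 2) / m.+1%:R)).
- exact: nearW.
- exact: cvg_cst.
- rewrite -[X in _ --> X]addr0; apply: cvgD; first exact: cvg_cst.
  rewrite -[X in _ --> X](mulr0 (ln (n ^ k)%:R / 2)); apply: cvgM; first exact: cvg_cst.
  exact: cvg_harmonic.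
Qed.

End LogSingular.

(** * Pseudo-unitary matrices *)

Section Signature.
Context {R : realType}.
Local Notation C := R[i].
Variables c d : nat.

Definition Jmx : 'M[C]_(c + d) := block_mx 1%:M 0 0 (- 1%:M).

Lemma JmxE : Jmx = diag_mx (\row_(i < c + d) (if (i < c)%N then 1 else -1)).
Proof.
apply/matrixP => i j; rewrite !mxE.
case: splitP => k ik; rewrite mxE; case: splitP => l jl; rewrite !mxE.
- by rewrite -[i == j]val_eqE /= ik jl val_eqE.
- rewrite -[i == j]val_eqE /= ik jl ltn_eqF // ltn_addr //.
- rewrite -[i == j]val_eqE /= ik jl eq_sym ltn_eqF // ltn_addr //.
- rewrite -[i == j]val_eqE /= ik jl eqn_add2l val_eqE.
  by rewrite mulNrn.
Qed.

Lemma mulmx_Jmx : Jmx *m Jmx = 1%:M.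
Proof.
rewrite mulmx_block !mulmx0 !mul0mx !addr0 !add0r mul1mx mulmxN mulNmx opprK mul1mx.
by rewrite -scalar_mx_block.
Qed.

(** Sylvester's normal form: [B] is a unitary diagonalisation of [G], positive eigenvalues first,
    followed by scaling with the square roots of their moduli. *)
Lemma has_signature_factor (G : 'M[C]_(c + d)) : G \is hermsymmx ->
  has_signature c d G ->
  exists2 B : 'M[C]_(c + d), B \in unitmx & B^t* *m Jmx *m B = G.
Proof.
move=> Gh [cc cd]; set s := eigenvalues G in cc cd.
pose pos := (fun z : C => 0 < z); pose neg := (fun z : C => z < 0).
have sc : size (seq.filter pos s) = c by rewrite size_filter.
have sd : size (seq.filter neg s) = d by rewrite size_filter.
(* The [c] positive and [d] negative eigenvalues already exhaust the size [c + d]: the negative ones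
   form a subsequence of the non-positive-filtered rest, and both have length [d]. *)
have pt : perm_eq (seq.filter pos s ++ seq.filter neg s) s.
  have : perm_eq (seq.filter pos s ++ seq.filter (predC pos) s) s by rewrite perm_filterC.
  congr (perm_eq (_ ++ _) _); apply/esym/eqP.
  have sub : subseq (seq.filter neg s) (seq.filter (predC pos) s).
    have -> : seq.filter neg s = seq.filter neg (seq.filter (predC pos) s).
      rewrite -filter_predI; apply: eq_filter => z /=.
      rewrite /neg /pos; case z0 : (z < 0) => //=; apply/esym.
      by rewrite lt_gtF.
    exact: filter_subseq.
  rewrite -(size_subseq_leqif sub) sd size_filter.
  have := count_predC pos s; rewrite size_eigenvalues cc => /addnI ->.
  exact: eqxx.
have [P uP ->] := spectral_reorder Gh pt.
set t := _ ++ _.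
have tpos i : (i < c)%N -> 0 < t`_i.
  move=> ic; rewrite nth_cat sc ic.
  have /mem_nth -/(_ 0) : (i < size (seq.filter pos s))%N by rewrite sc.
  by rewrite mem_filter => /andP[].
have tneg i : (c <= i)%N -> (i < c + d)%N -> t`_i < 0.
  move=> ci icd; rewrite nth_cat sc ltnNge ci /=.
  have /mem_nth -/(_ 0) : (i - c < size (seq.filter neg s))%N by rewrite sd ltn_subLR.
  by rewrite mem_filter => /andP[].
pose r : 'rV[C]_(c + d) := \row_i sqrtC `|t`_i|.
have r0 i : 0 < r 0 i.
  rewrite mxE sqrtC_gt0 normr_gt0.
  by have [/tpos/lt0r_neq0|/tneg/(_ (ltn_ord i))/ltr0_neq0] := ltnP i c.
exists (diag_mx r *m P).
  rewrite unitmx_mul (unitarymx_unit uP) andbT unitmxE det_diag unitfE.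
  by apply/prodf_neq0 => i _; rewrite gt_eqF.
rewrite trmx_mul map_mxM !mulmxA; congr (_ *m P); rewrite -!mulmxA; congr (_ *m _).
have -> : (diag_mx r)^t* = diag_mx r.
  rewrite tr_diag_mx; apply/matrixP => i j; rewrite !mxE.
  rewrite rmorphMn /=; congr (_ *+ _); apply/CrealP.
  by have := gtr0_real (r0 i); rewrite mxE.
rewrite JmxE !mulmx_diag; congr diag_mx; apply/rowP => i; rewrite !mxE.
have [/tpos ti|/tneg/(_ (ltn_ord i)) ti] := ltnP i c.
  by rewrite mul1r -expr2 sqrtCK gtr0_norm.
by rewrite mulN1r mulrN -expr2 sqrtCK ltr0_norm // opprK.
Qed.

End Signature.
Arguments Jmx {R}.

Lemma mxrank_diag_ge (F : fieldType) n (r : 'rV[F]_n) :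
  (#|[pred i | r 0%R i != 0%R]| <= \rank (diag_mx r))%N.
Proof.
set A := [pred i | _].
have f_inj : injective (@enum_val _ (mem A)) by exact: enum_val_inj.
pose f := @enum_val _ (mem A).
have u : mxsub f f (diag_mx r) \in unitmx.
  have -> : mxsub f f (diag_mx r) = diag_mx (\row_i r 0 (f i)).
    by apply/matrixP => i j; rewrite !mxE (inj_eq f_inj).
  rewrite unitmxE det_diag unitfE; apply/prodf_neq0 => i _; rewrite mxE.
  by have := enum_valP i; rewrite inE.
have <- : \rank (mxsub f f (diag_mx r)) = #|A| by exact: mxrank_unit.
have -> : mxsub f f (diag_mx r) = mxsub f id 1%:M *m diag_mx r *m mxsub id f 1%:M.
  by rewrite -[in LHS](mulmx1 (diag_mx r)) mxsub_mul -[in LHS](mul1mx (diag_mx r))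
    mxsub_mul mxsub_id.
exact: leq_trans (mxrankM_maxl _ _) (mxrankM_maxr _ _).
Qed.

Lemma mxrank_antidiag_block (F : fieldType) c d (X : 'M[F]_(c, d)) (Y : 'M[F]_(d, c)) :
  (\rank (block_mx 0 X Y 0) <= 2 * minn c d)%N.
Proof.
rewrite block_mxEv -addsmxE; apply: (leq_trans (mxrank_adds_leqif _ _)).
rewrite mul2n -addnn leq_add //.
  have -> : row_mx 0 X = X *m row_mx 0 1%:M :> 'M[F]_(c, c + d).
    by rewrite mul_mx_row mulmx0 mulmx1.
  by apply: (leq_trans (mxrankM_maxl _ _)); rewrite leq_min rank_leq_row rank_leq_col.
have -> : row_mx Y 0 = Y *m row_mx 1%:M 0 :> 'M[F]_(d, c + d).
  by rewrite mul_mx_row mulmx0 mulmx1.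
by apply: (leq_trans (mxrankM_maxl _ _)); rewrite leq_min rank_leq_row rank_leq_col.
Qed.

Section PseudoUnitary.
Context {R : realType}.
Local Notation C := R[i].
Variables c d : nat.
Implicit Type M : 'M[C]_(c + d).

Lemma adjmx_mul m n p (A : 'M[C]_(m, n)) (B : 'M[C]_(n, p)) :
  (A *m B)^t* = B^t* *m A^t*.
Proof. by rewrite trmx_mul map_mxM. Qed.

Lemma adj_block_mx m1 m2 n1 n2 (A : 'M[C]_(m1, n1)) (B : 'M[C]_(m1, n2))
    (A' : 'M[C]_(m2, n1)) (B' : 'M[C]_(m2, n2)) :
  (block_mx A B A' B')^t* = block_mx (A^t*) (A'^t*) (B^t*) (B'^t*).
Proof. by rewrite tr_block_mx map_block_mx. Qed.

Lemma normc_det_adj n (A : 'M[C]_n) : normc (\det (A^t*)) = normc (\det A).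
Proof.
rewrite det_map_mx det_tr; apply: complexI.
by rewrite -!normrE_normc norm_conjC.
Qed.

Lemma pseudo_unitary_mul n (G S T : 'M[C]_n) :
  pseudo_unitary G S -> pseudo_unitary G T -> pseudo_unitary G (S *m T).
Proof.
rewrite /pseudo_unitary /= => SG TG.
by rewrite adjmx_mul -!mulmxA (mulmxA G) (mulmxA (S^t*)) (mulmxA (S^t*)) SG mulmxA.
Qed.

Section OneMatrix.
Variable M : 'M[C]_(c + d).
Hypothesis MU : pseudo_unitary (Jmx c d) M.
Let J : 'M[C]_(c + d) := Jmx c d.
Let H := M^t* *m M.
Let Ma := ulsubmx M.
Let Mb := ursubmx M.
Let Mc := dlsubmx M.
Let Md := drsubmx M.
Let MJM : M^t* *m J *m M = J := MU.

Let ME : M = block_mx Ma Mb Mc Md. Proof. by rewrite submxK. Qed.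

Lemma pseudo_unitary_invl : J *m M^t* *m J *m M = 1%:M.
Proof. by rewrite -!mulmxA (mulmxA (M^t*)) MJM mulmx_Jmx. Qed.

Lemma pseudo_unitary_invr : M *m (J *m M^t* *m J) = 1%:M.
Proof. exact/mulmx1C/pseudo_unitary_invl. Qed.

Lemma pseudo_unitary_unit : M \in unitmx.
Proof. by have [] := mulmx1_unit pseudo_unitary_invr. Qed.

(** As [J M^t* J] is a two-sided inverse of [M], also [M J M^t* = J]; so [H] is itself
    pseudo-unitary and conjugation by [J] inverts it. *)
Lemma gram_pseudo_unitary : H *m (J *m H *m J) = 1%:M.
Proof.
have E : M *m J *m M^t* = J.
  by have := congr1 (mulmx^~ J) pseudo_unitary_invr; rewrite mul1mx -!mulmxA mulmx_Jmx mulmx1 !mulmxA.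
rewrite /H -!mulmxA (mulmxA J (M^t*)) (mulmxA M) (mulmxA M) E.
by rewrite !mulmxA MJM mulmx_Jmx.
Qed.

Lemma normc_det_pseudo_unitary : normc (\det M) = 1.
Proof.
have : \det (M^t* *m J *m M) = \det J by rewrite MJM.
have J0 : \det J != 0.
  have := congr1 determinant (@mulmx_Jmx R c d); rewrite det_mulmx det1 -/J => /eqP.
  by apply: contraTneq => ->; rewrite mul0r eq_sym oner_eq0.
rewrite !det_mulmx mulrAC -[RHS]mul1r => /(mulIf J0) /(congr1 (@normc R)).
rewrite normcM normc_det_adj normc1 -expr2 => /eqP.
by rewrite sqrp_eq1 ?normc_ge0 // => /eqP.
Qed.

Let blocks : [/\ Ma^t* *m Ma - Mc^t* *m Mc = 1%:M,
  Ma^t* *m Mb - Mc^t* *m Md = 0 & Md^t* *m Md - Mb^t* *m Mb = 1%:M].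
Proof.
have := MJM; rewrite ME adj_block_mx /J /Jmx !mulmx_block.
rewrite !(mulmx0, mulmx1, addr0, add0r, mulmxN, mulNmx).
by case/eq_block_mx => -> -> _ /(congr1 (fun x => - x)); rewrite opprD !opprK addrC.
Qed.

(** Conjugation by [J] flips the sign of the off-diagonal blocks, so they cancel and the diagonal
    ones double. The eigenvalues of the left side are [s^2 + s^-2 + 2 = (s + 1/s)^2], with [s]
    running over the singular values. *)
Lemma cosh_gram : H + J *m H *m J + 2%:M = 4 *: block_mx (Ma^t* *m Ma) 0 0 (Md^t* *m Md).
Proof.
have [Ea _ Ed] := blocks.
rewrite /H ME adj_block_mx /J /Jmx !mulmx_block.
rewrite !(mulmx0, mul0mx, mul1mx, mulmx1, addr0, add0r, mulmxN, mulNmx, opprK).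
rewrite (scalar_mx_block c d) !add_block_mx !subrr !addr0 scale_block_mx !scaler0.
have -> : Mc^t* *m Mc = Ma^t* *m Ma - 1%:M by rewrite -Ea opprB addrCA subrr addr0.
have -> : Mb^t* *m Mb = Md^t* *m Md - 1%:M by rewrite -Ed opprB addrCA subrr addr0.
have E n (X : 'M[C]_n) : X + (X - 1%:M) + (X + (X - 1%:M)) + 2%:M = 4 *: X.
  apply/matrixP => i j; rewrite !mxE.
  by case: (i == j); rewrite ?(mulr1n, mulr0n); ring.
by rewrite E [X in block_mx _ _ _ (X + X + _)]addrC E.
Qed.

(** Multiplying [M] by the identity whose second block column is replaced by that of
    [M^-1 = J M^t* J] gives a block triangular matrix with determinant [det Ma]; moreover
    [|det M| = 1]. *)
Lemma normc_det_blocks : normc (\det Ma) = normc (\det Md).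
Proof.
have := pseudo_unitary_invr; rewrite {1 2}ME adj_block_mx /J /Jmx !mulmx_block.
rewrite !(mulmx0, mul0mx, mul1mx, mulmx1, addr0, add0r, mulmxN, mulNmx, opprK).
rewrite (scalar_mx_block c d) => /eq_block_mx[_ E2 _ E4].
have : M *m block_mx 1%:M (- Mc^t*) 0 (Md^t*) = block_mx Ma 0 Mc 1%:M.
  rewrite {1}ME mulmx_block !(mulmx0, mulmx1, addr0, mulmxN).
  by rewrite E2 E4.
move=> /(congr1 (fun X => normc (\det X))).
rewrite det_mulmx det_ublock det_lblock !det1 mul1r mulr1 normcM.
by rewrite normc_det_pseudo_unitary mul1r normc_det_adj.
Qed.

(* At least |c - d| of the singular values of M are therefore equal to 1. *)
Lemma mxrank_gram_sub1 : (\rank (H - 1%:M)%R <= 2 * minn c d)%N.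
Proof.
(* The first factor is [M^t* - M^-1], whose diagonal blocks vanish. *)
have -> : H - 1%:M = (M^t* - J *m M^t* *m J) *m M.
  by rewrite mulmxBl pseudo_unitary_invl.
rewrite {1 2}ME adj_block_mx /J /Jmx !mulmx_block.
rewrite !(mulmx0, mul0mx, mul1mx, mulmx1, addr0, add0r, mulmxN, mulNmx, opprK).
rewrite opp_block_mx add_block_mx !subrr !opprK.
exact: leq_trans (mxrankM_maxl _ _) (mxrank_antidiag_block _ _).
Qed.

End OneMatrix.
End PseudoUnitary.

(** * [N_d] as the logarithm of a determinant *)

Section NsumDet.
Context {R : realType}.
Local Notation C := R[i].
Variables (c d : nat) (M : 'M[C]_(c + d)).
Hypothesis MU : pseudo_unitary (Jmx c d) M.
Local Notation J := (Jmx c d : 'M[C]_(c + d)).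
Local Notation H := (M^t* *m M).
Local Notation s := (singular_values M).
Local Notation n := (c + d)%N.

Lemma singular_valuesE m (T : 'M[C]_m) :
  singular_values T = [seq singular_value T i | i : 'I_m].
Proof.
rewrite -[LHS](mkseq_nth 0) size_singular_values /mkseq -val_enum_ord -map_comp.
by [].
Qed.

Lemma unitmx_Jmx : J \in unitmx.
Proof. by have [] := mulmx1_unit (@mulmx_Jmx R c d). Qed.

Lemma invmx_Jmx : invmx J = J.
Proof. by rewrite -[LHS]mulmx1 -(@mulmx_Jmx R c d) mulKmx // unitmx_Jmx. Qed.

(** One unitary [P] serves both matrices because [J H J] is the inverse of [H]. *)
Lemma gram_conj_J : exists P : 'M[C]_n, [/\ P \is unitarymx,
  H = P^t* *m diag_mx (\row_(i < n) ((singular_value M i) ^+ 2)%:C) *m P &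
  J *m H *m J = P^t* *m diag_mx (\row_(i < n) ((singular_value M i) ^- 2)%:C) *m P].
Proof.
have uM := pseudo_unitary_unit MU.
have [P uP HE] := gram_singular M; exists P; split => //.
set X := RHS.
have HX : H *m X = 1%:M.
  rewrite HE /X !mulmxA -(mulmxA (_ *m diag_mx _)) (unitarymxP uP) mulmx1.
  rewrite -(mulmxA (P^t*)) mulmx_diag (_ : \row_i _ = const_mx 1); last first.
    apply/rowP => i; rewrite !mxE -rmorphM /= mulfV // expf_neq0 //.
    by rewrite gt_eqF // singular_value_gt0.
  by rewrite diag_const_mx mulmx1 (mulmx_adj_unitary uP).
by rewrite -[LHS]mul1mx -(mulmx1C HX) -(mulmxA X H) (gram_pseudo_unitary MU) mulmx1.
Qed.

(** [J H J] has the spectrum of [H], being conjugate to it, and the inverse spectrum, being its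
    inverse. *)
Lemma singular_values_inv : perm_eq s [seq x^-1 | x <- s].
Proof.
have [P [uP HE JHJ]] := gram_conj_J.
have uP' := unitarymx_unit uP; rewrite -!(invmx_unitary uP) in HE JHJ.
have e1 : perm_eq (eigenvalues H) [seq ((singular_value M i) ^+ 2)%:C | i : 'I_n].
  have := eigenvalues_conj_diag (\row_(i < n) ((singular_value M i) ^+ 2)%:C) uP'.
  rewrite -HE => /perm_trans; apply.
  by under eq_map do rewrite mxE.
have e2 : perm_eq (eigenvalues H) [seq ((singular_value M i) ^- 2)%:C | i : 'I_n].
  have := eigenvalues_conj_diag (\row_(i < n) ((singular_value M i) ^- 2)%:C) uP'.
  rewrite -JHJ (_ : [seq _ | i <- _] = [seq ((singular_value M i) ^- 2)%:C | i : 'I_n]); last first.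
    by apply: eq_map => i; rewrite mxE.
  apply: perm_trans; apply: prod_XsubC_eq; rewrite -!eigenvaluesE.
  by rewrite -{1}invmx_Jmx char_poly_conj // unitmx_Jmx.
have /(perm_map (fun z => Num.sqrt (complex.Re z))) : perm_eq
    [seq ((singular_value M i) ^+ 2)%:C | i : 'I_n]
    [seq ((singular_value M i) ^- 2)%:C | i : 'I_n].
  by rewrite perm_sym in e1; exact: perm_trans e1 e2.
rewrite -[X in perm_eq X]map_comp -[X in perm_eq _ X]map_comp.
rewrite singular_valuesE -[X in _ -> perm_eq _ X]map_comp.
congr (perm_eq _ _); apply: eq_map => i /=.
  by rewrite sqrtr_sqr ger0_norm ?singular_value_ge0.
by rewrite -exprVn sqrtr_sqr ger0_norm // invr_ge0 singular_value_ge0.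
Qed.

Lemma count_singular_values (p : R -> bool) : count p s = #|[pred i : 'I_n | p (singular_value M i)]|.
Proof.
rewrite singular_valuesE count_map cardE /enum_mem size_filter count_filter.
by apply: eq_count => i; rewrite /= !inE andbT.
Qed.

Lemma count_gt1_lt1 : count (fun x => x < 1) s = count (fun x => 1 < x) s.
Proof.
have uM := pseudo_unitary_unit MU.
rewrite (seq.permP singular_values_inv) count_map; apply: eq_in_count => x.
rewrite singular_valuesE => /mapP[i _ ->] /=.
by rewrite invf_lt1 // singular_value_gt0.
Qed.

(** The rank of [H - 1] bounds the number of singular values different from 1, and by the inversion
    symmetry half of these exceed 1. *)
Lemma count_gt1_le : (count (fun x : R => 1 < x)%R s <= minn c d)%N.
Proof.
have := mxrank_gram_sub1 MU; have [P uP ->] := gram_singular M.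
rewrite -(mulmx_adj_unitary uP) -[X in _ - X *m _]mulmx1 -mulmxBl -mulmxBr.
have uP' := unitarymx_unit uP.
rewrite mxrankMfree ?row_free_unit // -mxrank_tr trmx_mul.
rewrite mxrankMfree ?row_free_unit ?unitmx_tr; last by rewrite -(invmx_unitary uP) unitmx_inv.
rewrite mxrank_tr -diag_const_mx -raddfB /=.
move=> /(leq_trans (mxrank_diag_ge _)) le2.
rewrite -(leq_pmul2l (isT : 0 < 2)%N); apply: leq_trans le2.
rewrite mul2n -addnn -{1}count_gt1_lt1 -count_predUI addnC.
rewrite (eq_count (a2 := pred0)) ?count_pred0 => [|x]; last first.
  by rewrite /= ; case: ltgtP.
rewrite add0n count_singular_values; apply/subset_leq_card/fintype.subsetP => i.
rewrite !inE !mxE -rmorphB /= => i1; apply/negP => /eqP/complexI/eqP.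
rewrite subr_eq0 sqrp_eq1 ?singular_value_ge0 // => /eqP E.
by move: i1; rewrite E ltxx.
Qed.

Lemma singular_gt1_lt i : (i < n)%N -> 1 < singular_value M i -> (i < d)%N.
Proof.
move=> ltin si; apply: (@leq_trans (minn c d)); last exact: geq_minr.
apply: leq_trans count_gt1_le.
rewrite -[s](cat_take_drop i.+1) count_cat -[leqLHS]addn0 leq_add //.
have sz : size (take i.+1 s) = i.+1 by rewrite size_takel // size_singular_values.
rewrite -[X in (X <= _)%N]sz.
suff: all (fun x : R => 1 < x) (take i.+1 s) by rewrite all_count => /eqP ->.
apply/(all_nthP 0) => j; rewrite sz ltnS => ji; rewrite nth_take //.
by apply: lt_le_trans si _; exact: singular_value_le.
Qed.

(** A value below 1 at an index [i < d] would force all [n - i > c] values from there on below 1,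
    whereas at most [min(c,d)] are. *)
Lemma singular_ge1 i : (i < d)%N -> 1 <= singular_value M i.
Proof.
move=> ltid; rewrite leNgt; apply/negP => si.
have : (n - i <= c)%N.
  apply: (@leq_trans (minn c d)); last exact: geq_minl.
  apply: leq_trans count_gt1_le; rewrite -count_gt1_lt1.
  rewrite -[s](cat_take_drop i) count_cat; apply: leq_trans (leq_addl _ _).
  have sz : size (drop i s) = (n - i)%N by rewrite size_drop size_singular_values.
  rewrite -[X in (X <= _)%N]sz.
  suff: all (fun x : R => x < 1) (drop i s) by rewrite all_count => /eqP ->.
  apply/(all_nthP 0) => j; rewrite nth_drop => _.
  by apply: le_lt_trans si; apply: singular_value_le; exact: leq_addr.
by rewrite leq_subLR addnC leq_add2r leqNgt ltid.
Qed.

(** For [x = exp t] this is the logarithm of [cosh t], hence invariant under [x -> 1/x] and zero at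
    1. *)
Definition ln_cosh (x : R) : R := ln ((x + x^-1) / 2).

Lemma ln_coshV x : ln_cosh x^-1 = ln_cosh x.
Proof. by rewrite /ln_cosh invrK addrC. Qed.

Lemma ln_cosh1 : ln_cosh 1 = 0.
Proof. by rewrite /ln_cosh invr1 -[1 + 1]/2%:R divff ?pnatr_eq0 // ln1. Qed.

(** Values above 1 only occur among the first [d]; any other value there equals 1 and contributes
    nothing. *)
Lemma Nsum_gt1 : Nsum d M = \sum_(x <- s | 1 < x) ln_cosh x.
Proof.
transitivity (\sum_(0 <= i < d) ln_cosh (singular_value M i)).
  by rewrite big_mkord.
rewrite [RHS](big_nth 0) size_singular_values [RHS](big_cat_nat _ (n := d)) ?leq_addl //=.
rewrite [X in _ = _ + X]big1_seq ?addr0; last first.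
  move=> i /andP[si]; rewrite mem_index_iota => /andP[di ltin].
  by have := singular_gt1_lt ltin si; rewrite ltnNge di.
rewrite [RHS]big_mkcond [LHS]big_seq [RHS]big_seq /=.
apply: eq_bigr => i; rewrite mem_index_iota => /= ltid.
case: ifPn => //; rewrite -leNgt => le1.
have -> : singular_value M i = 1 by apply/le_anti; rewrite le1 singular_ge1.
exact: ln_cosh1.
Qed.

Lemma sum_ln_cosh : \sum_(x <- s) ln_cosh x = Nsum d M *+ 2.
Proof.
rewrite Nsum_gt1 mulr2n (bigID (fun x => 1 < x)) /=; congr (_ + _).
transitivity (\sum_(x <- s | x < 1) ln_cosh x).
  rewrite (bigID (fun x => x == 1)) /= big1 ?add0r => [|x /andP[_ /eqP->]]; last exact: ln_cosh1.
  by apply: eq_bigl => x; case: ltgtP.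
rewrite (perm_big _ singular_values_inv) big_map big_seq_cond [RHS]big_seq_cond.
apply: eq_big => [x|x _]; last exact: ln_coshV.
case: (boolP (x \in s)) => //=; rewrite singular_valuesE => /mapP[i _ ->].
by rewrite invf_lt1 // singular_value_gt0 // pseudo_unitary_unit.
Qed.

(** Taking determinants in [cosh_gram] gives the product of all [(s + 1/s)^2] as
    [4^n |det Ma|^2 |det Md|^2], which is [4^n D^4] since the two blocks have determinants of equal
    modulus. Thus the product of the [(s + 1/s)/2] is [D^2], and its logarithm is twice [N_d] by the
    pairing of [s] with [1/s]. *)
Lemma Nsum_ln_det : Nsum d M = ln (normc (\det (drsubmx M))).
Proof.
have uM := pseudo_unitary_unit MU.
have s0 (i : 'I_n) : 0 < singular_value M i by rewrite singular_value_gt0.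
have c0 (i : 'I_n) : 0 < (singular_value M i + (singular_value M i)^-1) / 2.
  by rewrite divr_gt0 ?addr_gt0 ?invr_gt0.
have [P [uP HE JHJ]] := gram_conj_J.
have := congr1 determinant (cosh_gram MU).
rewrite JHJ HE.
have -> : 2%:M = P^t* *m diag_mx (const_mx 2) *m P :> 'M[C]_n.
  by rewrite diag_const_mx mul_mx_scalar -scalemxAl (mulmx_adj_unitary uP) scalemx1.
rewrite -!mulmxDl -!mulmxDr -!raddfD /= !det_mulmx mulrAC -det_mulmx.
rewrite (mulmx_adj_unitary uP) det1 mul1r det_diag detZ det_lblock !det_mulmx.
move=> /(congr1 (@normc R)); rewrite !normcM !normc_det_adj.
rewrite (normc_det_blocks MU) normc_prod.
set D := normc (\det (drsubmx M)) => E.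
have Eprod : \prod_(i < n) ((singular_value M i + (singular_value M i)^-1) / 2) = D ^+ 2.
  have P0 : 0 <= \prod_(i < n) ((singular_value M i + (singular_value M i)^-1) / 2).
    by apply: prodr_ge0 => i _; exact: ltW.
  apply/eqP; rewrite -(@eqrXn2 _ 2) ?exprn_ge0 ?normc_ge0 //; apply/eqP.
  rewrite -exprM (_ : D ^+ (2 * 2) = D * D * (D * D)); last by ring.
  have four0 : normc (4 ^+ n : C) != 0 by rewrite gt_eqF // normc_gt0 expf_neq0 // pnatr_eq0.
  apply: (mulfI four0); rewrite -E -prodrXl.
  have -> : normc (4 ^+ n : C) = \prod_(i < n) 4.
    rewrite prodr_const card_ord -natr_complex.
    by rewrite -rmorphXn normc_real ger0_norm // exprn_ge0.
  rewrite -big_split /=; apply: eq_bigr => i _; rewrite !mxE.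
  have -> : ((singular_value M i ^+ 2)%:C + (singular_value M i ^- 2)%:C + 2) =
     (((singular_value M i ^+ 2) + (singular_value M i ^- 2) + 2)%:C : C).
    by rewrite -[X in _ + X]natr_complex -!rmorphD.
  rewrite normc_real ger0_norm; last first.
    by rewrite !addr_ge0 // ?invr_ge0 exprn_ge0 // ltW.
  by have := s0 i; move: (singular_value M i) => x x0; field; rewrite gt_eqF.
have D0 : 0 < D.
  have : 0 < D ^+ 2 by rewrite -Eprod; exact: prodr_gt0.
  have : 0 <= D by exact: normc_ge0.
  by rewrite le_eqVlt => /predU1P[<-|//]; rewrite expr0n ltxx.
have := sum_ln_cosh; rewrite singular_valuesE big_image /= -ln_prod // Eprod lnXn //.
by move=> /pmulrnI -> .
Qed.

(** For [x >= 1] one has [(x + 1/x)/2 <= x <= x + 1/x], and the first [d] singular values are at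
    least 1. *)
Lemma Nsum_ln_sigma : Nsum d M <= ln_sigma d M <= Nsum d M + ln 2 *+ d.
Proof.
have E : ln_sigma d M = \sum_(i < d) ln (singular_value M i) by [].
have -> : ln 2 *+ d = \sum_(i < d) (ln 2 : R) by rewrite sumr_const card_ord.
rewrite /Nsum -big_split E /=; apply/andP; split; apply: ler_sum => i _;
  have := singular_ge1 (ltn_ord i); move: (singular_value M i) => x x1;
  have x0 : 0 < x by exact: lt_le_trans x1.
  rewrite ler_ln ?posrE ?divr_gt0 ?addr_gt0 ?invr_gt0 //.
  rewrite ler_pdivrMr // mulrDr mulr1 lerD2l.
  by apply: (le_trans _ x1); rewrite invf_le1.
rewrite -lnM ?posrE ?divr_gt0 ?addr_gt0 ?invr_gt0 // divfK ?pnatr_eq0 //.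
by rewrite ler_ln ?posrE ?addr_gt0 ?invr_gt0 // lerDl invr_ge0 ltW.
Qed.

Lemma Nsum_ge0 : 0 <= Nsum d M.
Proof.
apply: sumr_ge0 => i _; have := singular_ge1 (ltn_ord i).
move: (singular_value M i) => x x1; have x0 : 0 < x by exact: lt_le_trans x1.
apply: ln_ge0; rewrite ler_pdivlMr // mul1r -subr_ge0.
have -> : x + x^-1 - 2 = (x - 1) ^+ 2 / x by field; rewrite gt_eqF.
by rewrite divr_ge0 ?sqr_ge0 // ltW.
Qed.

End NsumDet.

(** * Means over the unit circle *)

Section CircleMean.
Context {R : realType}.
Local Notation C := R[i].
Local Notation leb := (@lebesgue_measure R).

Lemma continuous_integrable_itv (G : R -> R) a b : continuous G ->
  leb.-integrable `[a, b] (EFin \o G).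
Proof.
move=> cG; apply: continuous_compact_integrable; first exact: segment_compact.
exact: continuous_subspaceT.
Qed.

Lemma continuous_affine_comp (G : R -> R) (s t : R) : continuous G ->
  continuous (fun x => G (s * x + t)).
Proof.
move=> cG x; apply: (@continuous_comp _ _ _ (fun x => s * x + t) G); last exact: cG.
by apply: cvgD; [apply: cvgM; [exact: cvg_cst|exact: cvg_id]|exact: cvg_cst].
Qed.

Lemma Rintegral_affine (G : R -> R) (s t a b : R) : 0 < s -> a <= b -> continuous G ->
  \int[leb]_(x in `[s * a + t, s * b + t]) G x =
  s * \int[leb]_(x in `[a, b]) G (s * x + t).
Proof.
move=> s0 ab cG.
pose F (x : R) : R := s * x + t.
have dF (x : R) : is_derive x (1 : R) F s.
  rewrite /F; apply: is_derive_eq.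
  by rewrite addr0 /GRing.scale /= mulr1.
have cF : continuous F.
  move=> x; apply/differentiable_continuous/derivable1_diffP; exact: ex_derive.
have F'E : derive1 F = cst s by apply/funext => x; rewrite derive1E derive_val.
rewrite -RintegralZl //; last first.
  exact/continuous_integrable_itv/continuous_affine_comp.
rewrite /Rintegral (@integration_by_substitution_increasing _ F) //.
- by congr fine; apply: eq_integral => x _; rewrite /= F'E /= mulrC.
- by move=> x y _ _ xy; rewrite /F ltrD2r ltr_pM2l.
- by rewrite F'E => x _; exact: cst_continuous.
- by rewrite F'E; exact: is_cvg_cst.
- by rewrite F'E; exact: is_cvg_cst.
- split.
  + by move=> x _; exact: ex_derive.
  + by apply: cvg_at_right_filter; exact: cF.
  + by apply: cvg_at_left_filter; exact: cF.
- exact: continuous_subspaceT.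
Qed.

Lemma Rintegral_unit_cst (r : R) : \int[leb]_(x in `[0, 1]) r = r.
Proof.
rewrite Rintegral_cst //.
have := lebesgue_measure_itv (R := R) `[0%R, 1%R]; rewrite /= lte_fin ltr01 oppr0 adde0 => ->.
exact: mulr1.
Qed.

Lemma Rintegral_split (G : R -> R) (a m b : R) : a <= m -> m <= b -> continuous G ->
  \int[leb]_(x in `[a, b]) G x =
  \int[leb]_(x in `[a, m]) G x + \int[leb]_(x in `[m, b]) G x.
Proof.
move=> am mb cG; have := @Rintegral_itvB _ G (BLeft a) (BRight b) m.
move=> /(_ (continuous_integrable_itv _ _ cG)).
rewrite !bnd_simp => /(_ am mb) /eqP; rewrite subr_eq addrC => /eqP ->.
congr (_ + _); apply: Rintegral_itv_obnd_cbnd.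
apply: integrableS (continuous_integrable_itv m b cG) => //.
by apply: subset_itvr; rewrite bnd_simp.
Qed.

Lemma expi2piD x y : expi2pi (x + y) = expi2pi x * expi2pi y :> C.
Proof.
rewrite /expi2pi mulrDr cosD sinD; apply/eqP; rewrite eq_complex /=.
by rewrite eqxx /= addrC [_ * cos (2 * pi * y)]mulrC mulrC [X in X + _]mulrC.
Qed.

Lemma normc_expi2pi x : normc (expi2pi x : C) = 1.
Proof. by rewrite /expi2pi /normc cos2Dsin2 sqrtr1. Qed.

Lemma expi2pi_half : expi2pi 2^-1 = -1 :> C.
Proof.
rewrite /expi2pi mulrAC divff ?pnatr_eq0 // mul1r cospi sinpi.
by apply/eqP; rewrite eq_complex /= oppr0 !eqxx.
Qed.

Lemma continuous_expi2pi :
  continuous (fun x : R => complex.Re (expi2pi x)) /\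
  continuous (fun x : R => complex.Im (expi2pi x)).
Proof.
have c2 : continuous (fun x : R => 2 * pi * x).
  by move=> x; apply: cvgM; [exact: cvg_cst|exact: cvg_id].
split => x /=.
  by apply: (@continuous_comp _ _ _ (fun x => 2 * pi * x) cos); [exact: c2|exact: continuous_cos].
by apply: (@continuous_comp _ _ _ (fun x => 2 * pi * x) sin); [exact: c2|exact: continuous_sin].
Qed.

Lemma continuous_normc (u : R -> C) :
  continuous (fun x => complex.Re (u x)) -> continuous (fun x => complex.Im (u x)) ->
  continuous (fun x => normc (u x)).
Proof.
move=> cr ci.
have -> : (fun x => normc (u x)) =
   (fun x => Num.sqrt (complex.Re (u x) * complex.Re (u x) + complex.Im (u x) * complex.Im (u x))).
  by apply/funext => x; case: (u x).
move=> x; apply: (@continuous_comp _ _ _ (fun x =>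
  (complex.Re (u x) * complex.Re (u x) + complex.Im (u x) * complex.Im (u x)))
  Num.sqrt); last exact: sqrt_continuous.
by apply: cvgD; apply: cvgM; (exact: cr || exact: ci).
Qed.

Lemma continuous_normc_lin (w : C) : continuous (fun x => normc (1 - w * expi2pi x)).
Proof.
have [cr ci] := continuous_expi2pi; case: w => a b.
apply: continuous_normc.
  move=> x; apply: cvgB; first exact: cvg_cst.
  by apply: cvgB; (apply: cvgM; [exact: cvg_cst|]); [exact: cr|exact: ci].
move=> x; apply: cvgB; first exact: cvg_cst.
by apply: cvgD; (apply: cvgM; [exact: cvg_cst|]); [exact: ci|exact: cr].
Qed.

Lemma normc_lin_bounds (w : C) x :
  1 - normc w <= normc (1 - w * expi2pi x) <= 1 + normc w.
Proof.
have nw : normc (w * expi2pi x) = normc w by rewrite normcM normc_expi2pi mulr1.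
apply/andP; split.
  by have := le_normcD (1 - w * expi2pi x) (w * expi2pi x); rewrite subrK normc1 nw lerBlDr.
by have := le_normcD 1 (- (w * expi2pi x)); rewrite normc1 normcN nw.
Qed.

Lemma continuous_ln_lin (w : C) : normc w < 1 ->
  continuous (fun x => ln (normc (1 - w * expi2pi x))).
Proof.
move=> w1 x; apply: (@continuous_comp _ _ _ (fun x => normc (1 - w * expi2pi x)) (@ln R)).
  exact: continuous_normc_lin.
apply: continuous_ln; have /andP[+ _] := normc_lin_bounds w x.
by apply: lt_le_trans; rewrite subr_gt0.
Qed.

(** With [e(x)] for [expi2pi x], the factors at [x] and [x + 1/2] multiply to [1 - w^2 e(2x)]. The
    integral is split at [1/2], the halves are superposed, and [2x] becomes the new variable. *)
Lemma Rintegral_ln_lin_double (w : C) : normc w < 1 ->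
  2 * \int[leb]_(x in `[0, 1]) ln (normc (1 - w * expi2pi x)) =
  \int[leb]_(x in `[0, 1]) ln (normc (1 - w ^+ 2 * expi2pi x)).
Proof.
move=> w1; have cw := continuous_ln_lin w1.
have w21 : normc (w ^+ 2) < 1.
  by rewrite expr2 normcM mulr_ilt1 // normc_ge0.
have cw2 := continuous_ln_lin w21.
have h0 : 0 <= 2^-1 :> R by rewrite invr_ge0.
have h1 : 2^-1 <= 1 :> R by rewrite invf_le1 // ler1n.
rewrite (Rintegral_split h0 h1 cw).
have := Rintegral_affine 2^-1 (ltr01 : 0 < 1 :> R) h0 cw.
have hh : 1 * 2^-1 + 2^-1 = 1 :> R by field.
rewrite hh mulr0 add0r mul1r => ->.
rewrite -RintegralD //; [|exact: continuous_integrable_itv|]; last first.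
  apply: (@continuous_integrable_itv (fun x : R => ln (normc (1 - w * expi2pi (1 * x + 2^-1))))).
  exact: (@continuous_affine_comp _ 1 2^-1 cw).
have := Rintegral_affine 0 (ltr0n R 2 : 0 < 2 :> R) h0 cw2.
rewrite mulr0 add0r addr0 divff ?pnatr_eq0 // => ->; congr (_ * _).
apply: eq_Rintegral => x _; rewrite -lnM; last 2 first.
- rewrite posrE; have /andP[+ _] := normc_lin_bounds w x.
  by apply: lt_le_trans; rewrite subr_gt0.
- rewrite posrE; have /andP[+ _] := normc_lin_bounds w (1 * x + 2^-1).
  by apply: lt_le_trans; rewrite subr_gt0.
rewrite mul1r expi2piD expi2pi_half addr0 (_ : 2 * x = x + x); last by ring.
rewrite expi2piD -normcM.
by congr (ln (normc _)); ring.
Qed.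

(* By the doubling formula I w = 2^-k I (w^(2^k)), where I is bounded. *)
Lemma Rintegral_ln_lin (w : C) : normc w < 1 ->
  \int[leb]_(x in `[0, 1]) ln (normc (1 - w * expi2pi x)) = 0.
Proof.
move=> w1; pose I (z : C) := \int[leb]_(x in `[0, 1]) ln (normc (1 - z * expi2pi x)).
have pow k : normc (w ^+ (2 ^ k)) <= normc w.
  have -> : normc (w ^+ (2 ^ k)) = normc w ^+ (2 ^ k).
    by elim: (2 ^ k)%N => [|m IH]; rewrite ?expr0 ?normc1 // !exprS normcM IH.
  rewrite -[leRHS]expr1; apply: ler_wiXn2l; rewrite ?normc_ge0 ?expn_gt0 //.
  exact: ltW.
have Ik k : (2 ^ k)%:R * I w = I (w ^+ (2 ^ k)).
  elim: k => [|k IH]; first by rewrite mul1r expr1.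
  rewrite expnS natrM -mulrA IH Rintegral_ln_lin_double; last exact: le_lt_trans (pow k) w1.
  by rewrite -exprM mulnC.
(* For [|z| <= |w|] the modulus inside the logarithm lies between [1 - |w|] and 2, so [K] bounds the
   integral at every power of [w] at once. *)
pose K := - ln (1 - normc w) + ln 2.
have l0 : 0 <= - ln (1 - normc w).
  by rewrite oppr_ge0 ln_le0 // lerBlDr lerDl normc_ge0.
have l2 : 0 <= ln (2 : R) by rewrite ln_ge0 // ler1n.
have IK z : normc z <= normc w -> `|I z| <= K.
  move=> zw; have z1 := le_lt_trans zw w1.
  apply: (le_trans (le_normr_Rintegral _ (continuous_integrable_itv _ _ (continuous_ln_lin z1)))) => //.
  apply: (@le_trans _ _ (\int[leb]_(x in `[0, 1]) K)).
    apply: le_Rintegral => //.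
    - apply: (@continuous_integrable_itv (fun x => `|ln (normc (1 - z * expi2pi x))|)) => x.
      apply: (@continuous_comp _ _ _ (fun x => ln (normc (1 - z * expi2pi x))) (fun y : R => `|y|)).
        exact: continuous_ln_lin.
      exact: norm_continuous.
    - by apply: (@continuous_integrable_itv (cst K)) => x; exact: cst_continuous.
    move=> x _; have /andP[b1 b2] := normc_lin_bounds z x.
    have zp : 0 < 1 - normc z by rewrite subr_gt0.
    have wp : 0 < 1 - normc w by rewrite subr_gt0.
    have p0 := lt_le_trans zp b1.
    have L1 : ln (1 - normc w) <= ln (normc (1 - z * expi2pi x)).
      rewrite ler_ln ?posrE //; apply: le_trans b1.
      by rewrite lerD2l lerN2.
    have L2 : ln (normc (1 - z * expi2pi x)) <= ln 2.
      by rewrite ler_ln ?posrE //; apply: (le_trans b2); rewrite (natrD _ 1 1) lerD2l ltW.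
    rewrite ler_norml /K; move: l0 l2 L1 L2.
    move: (ln _) (ln _) (ln _) => ? ? ? *; apply/andP; split; lra.
  by rewrite Rintegral_unit_cst.
apply/eqP; rewrite -/(I w) -normr_le0; apply/ler_addgt0Pl => e e0; rewrite addr0.
have K0 : 0 <= K by rewrite addr_ge0.
have [k ke] : exists k, K < e * (2 ^ k)%:R.
  exists (Num.bound (K / e)); rewrite mulrC -ltr_pdivrMr //.
  apply: lt_le_trans (archi_boundP _) _; first by rewrite divr_ge0 // ltW.
  by rewrite ler_nat ltnW // ltn_expl.
rewrite -(@ler_pM2r _ (2 ^ k)%:R) ?ltr0n ?expn_gt0 //.
apply: le_trans (ltW ke).
rewrite -[X in _ * X]ger0_norm // -normrM mulrC -/(I w) Ik.
exact/IK/pow.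
Qed.

(** Each factor is rewritten as [-z (1 - z^-1 e(x))] with [|z^-1| < 1], so by [Rintegral_ln_lin] a
    root contributes exactly [ln |z|]. Continuity is carried through the induction to split the
    integrals. *)
Lemma ln_prod_lin (l : C) (r : seq C) : l != 0 -> (forall z, z \in r -> 1 < normc z) ->
  continuous (fun x => ln (normc (l * \prod_(z <- r) (expi2pi x - z)))) /\
  \int[leb]_(x in `[0, 1]) ln (normc (l * \prod_(z <- r) (expi2pi x - z))) =
  ln (normc (l * \prod_(z <- r) (0 - z))).
Proof.
move=> l0; elim: r => [|z r IH] r1.
  have E x : ln (normc (l * \prod_(z <- [::]) (expi2pi x - z))) = ln (normc l).
    by rewrite big_nil mulr1.
  split; first by under eq_fun do rewrite E; exact: cst_continuous.
  transitivity (\int[leb]_(x in `[0, 1]) ln (normc l)).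
    by apply: eq_Rintegral => x _; rewrite E.
  by rewrite Rintegral_unit_cst big_nil mulr1.
have [|cr Ir] := IH; first by move=> y yr; apply: r1; rewrite inE yr orbT.
have z1 : 1 < normc z by apply: r1; rewrite inE eqxx.
have z0 : z != 0 by rewrite -normc_gt0 (lt_trans ltr01).
have zV : normc z^-1 < 1 by rewrite normcV invf_lt1 // (lt_trans ltr01).
have pr_gt0 x : 0 < normc (l * \prod_(z <- r) (expi2pi x - z)).
  rewrite normc_gt0 mulf_neq0 // prodf_seq_neq0; apply/allP => y yr /=.
  rewrite subr_eq0; apply/eqP => ey; have := r1 y; rewrite inE yr orbT => /(_ isT).
  by rewrite -ey normc_expi2pi ltxx.
have lin_gt0 x : 0 < normc (1 - z^-1 * expi2pi x).
  have /andP[+ _] := normc_lin_bounds z^-1 x.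
  by apply: lt_le_trans; rewrite subr_gt0.
have E x : ln (normc (l * \prod_(y <- z :: r) (expi2pi x - y))) =
   ln (normc z) + ln (normc (1 - z^-1 * expi2pi x)) +
   ln (normc (l * \prod_(z <- r) (expi2pi x - z))).
  rewrite -!lnM ?posrE ?mulr_gt0 ?lin_gt0 ?pr_gt0 ?normc_gt0 //.
  rewrite big_cons mulrCA normcM; congr (ln (_ * _)).
  by rewrite -normcM mulrBr mulr1 mulrA divff // mul1r -normcN opprB.
have cl := continuous_ln_lin zV.
have c1 : continuous (fun x => ln (normc z) + ln (normc (1 - z^-1 * expi2pi x))).
  by move=> y0; apply: cvgD; [exact: cvg_cst|exact: cl].
split.
  by under eq_fun do rewrite E; move=> x; apply: cvgD; [exact: c1|exact: cr].
transitivity (\int[leb]_(x in `[0, 1])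
  ((fun x => ln (normc z) + ln (normc (1 - z^-1 * expi2pi x))) x +
   (fun x => ln (normc (l * \prod_(z <- r) (expi2pi x - z)))) x)).
  by apply: eq_Rintegral => x _; rewrite E.
rewrite RintegralD //; [|exact: continuous_integrable_itv c1|exact: continuous_integrable_itv cr].
transitivity (\int[leb]_(x in `[0, 1])
  ((fun=> ln (normc z)) x + (fun x => ln (normc (1 - z^-1 * expi2pi x))) x) +
   ln (normc (l * \prod_(z0 <- r) (0 - z0)))); first by rewrite -Ir.
rewrite RintegralD //; [|exact: (continuous_integrable_itv _ _ (@cst_continuous _ _ _))
  |exact: continuous_integrable_itv cl].
rewrite Rintegral_ln_lin // addr0 Rintegral_unit_cst -lnM ?posrE ?normc_gt0 //; last first.
  rewrite mulf_neq0 // prodf_seq_neq0; apply/allP => y yr /=.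
  have := r1 y; rewrite inE yr orbT => /(_ isT) y1.
  by rewrite sub0r oppr_eq0 -normc_gt0 (lt_trans ltr01).
rewrite big_cons [in RHS]mulrCA normcM [in RHS]sub0r.
by rewrite [in RHS]normcM normcN -normcM.
Qed.

(** Jensen's formula for a polynomial without zeros in the closed disc. *)
Lemma Rintegral_ln_poly (p : {poly C}) : (forall z, normc z <= 1 -> p.[z] != 0) ->
  continuous (fun x => ln (normc p.[expi2pi x])) /\
  \int[leb]_(x in `[0, 1]) ln (normc p.[expi2pi x]) = ln (normc p.[0]).
Proof.
have [r pE] := closed_field_poly_normal p => p0.
have l0 : lead_coef p != 0.
  rewrite lead_coef_eq0; apply: contraTneq (p0 0 _) => [->|]; first by rewrite horner0 eqxx.
  by rewrite normc0.
have hE z : p.[z] = lead_coef p * \prod_(y <- r) (z - y).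
  by rewrite {1}pE hornerZ horner_prod; congr (_ * _); apply: eq_bigr => y _; rewrite hornerXsubC.
have r1 z : z \in r -> 1 < normc z.
  move=> zr; rewrite ltNge; apply/negP => /p0; rewrite hE mulf_eq0 (negPf l0) /=.
  by rewrite prodf_seq_neq0 => /allP /(_ _ zr); rewrite /= subrr eqxx.
have [c I] := ln_prod_lin l0 r1.
split; first by under eq_fun do rewrite hE.
by rewrite hE -I; apply: eq_Rintegral => x _; rewrite hE.
Qed.

End CircleMean.

(** * Matrix products twisted by a complex parameter *)

Fixpoint prodmx (F : nzRingType) n (a : nat -> 'M[F]_n) k : 'M[F]_n :=
  if k is k'.+1 then a k' *m prodmx a k' else 1%:M.

(** [Umx] with its phase replaced by an arbitrary ring element. Like [prodmx], it is defined over a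
    general ring in order to serve both complex numbers in the disc and the indeterminate of
    [{poly C}]. *)
Definition zmx (F : nzRingType) c d (z : F) : 'M[F]_(c + d) :=
  block_mx z%:M 0 0 1%:M.
Arguments zmx {F} c d z.

Lemma map_prodmx (F F' : nzRingType) (g : {rmorphism F -> F'}) n (a : nat -> 'M[F]_n) k :
  map_mx g (prodmx a k) = prodmx (fun j => map_mx g (a j)) k.
Proof. by elim: k => [|k IH] /=; rewrite ?map_mx1 // map_mxM IH. Qed.

Section Twisted.
Context {R : realType}.
Local Notation C := R[i].
Variables c d : nat.
Implicit Types (a : nat -> 'M[C]_(c + d)) (M : 'M[C]_(c + d)).

Definition twisted_prod a (z : C) k := prodmx (fun j => zmx c d z *m a j) k.

(** At [z = 0] the twist annihilates the upper block row, so the products are block lower triangular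
    and their lower right blocks multiply. *)
Lemma twisted_prod0 a k : ursubmx (twisted_prod a 0 k) = 0 /\
  \det (drsubmx (twisted_prod a 0 k)) = \prod_(j < k) \det (drsubmx (a j)).
Proof.
elim: k => [|k [IH1 IH2]].
  by rewrite /twisted_prod /= scalar_mx_block block_mxKur block_mxKdr det1 big_ord0.
rewrite /twisted_prod /= -/(twisted_prod a 0 k) -mulmxA.
rewrite -[twisted_prod a 0 k]submxK -{1 2}[a k]submxK IH1 !mulmx_block.
rewrite block_mxKur block_mxKdr; split.
  by rewrite -scalemx1 !scale0r !mul0mx addr0.
by rewrite !mulmx0 !mul0mx !mul1mx !add0r det_mulmx IH2 big_ord_recr /= mulrC.
Qed.

(** The hermitian form of [J], taken with real values so that it can be compared by inequalities. *)
Definition Jform (v : 'cV[C]_(c + d)) : R :=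
  \sum_(i < c) normc (v (lshift d i) 0) ^+ 2 - \sum_(i < d) normc (v (rshift c i) 0) ^+ 2.

Lemma JformE v : (Jform v)%:C = (v^t* *m Jmx c d *m v) 0 0.
Proof.
rewrite rmorphB !rmorph_sum /=.
have -> : v^t* = row_mx ((usubmx v)^t*) ((dsubmx v)^t*).
  by rewrite -{1}[v]vsubmxK tr_col_mx map_row_mx.
rewrite -[X in _ *m X]vsubmxK /Jmx mul_row_block mul_row_col !mulmx0 addr0 add0r mulmx1.
rewrite mulmxN mulmx1 mulNmx 2!mxE; congr (_ + _).
  by rewrite ?mxE; apply: eq_bigr => i _; rewrite !mxE mulrC conjC_normc.
rewrite ?mxE; congr (- _).
by apply: eq_bigr => i _; rewrite !mxE mulrC conjC_normc.
Qed.

Lemma Jform_pseudo_unitary M v : pseudo_unitary (Jmx c d) M -> Jform (M *m v) = Jform v.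
Proof.
move=> MU; apply: complexI; rewrite !JformE adjmx_mul.
by rewrite -!mulmxA (mulmxA (Jmx c d)) (mulmxA (M^t*)) (mulmxA (M^t*)) MU !mulmxA.
Qed.

Lemma Jform_zmx z v : normc z <= 1 -> Jform (zmx c d z *m v) <= Jform v.
Proof.
move=> z1; rewrite -{1}[v]vsubmxK /zmx mul_block_col !mul0mx addr0 add0r mul1mx mul_scalar_mx.
rewrite /Jform; apply: lerB.
  apply: ler_sum => i _; rewrite col_mxEu !mxE normcM exprMn ler_piMl ?sqr_ge0 //.
  by rewrite expr_le1 ?normc_ge0.
by apply: ler_sum => i _; rewrite col_mxEd !mxE.
Qed.

Lemma Jform_twisted a z k v : (forall j, pseudo_unitary (Jmx c d) (a j)) -> normc z <= 1 ->
  Jform (twisted_prod a z k *m v) <= Jform v.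
Proof.
move=> aU z1; elim: k => [|k IH]; first by rewrite /twisted_prod /= mul1mx.
rewrite /twisted_prod /= -/(twisted_prod a z k) -!mulmxA.
by apply: (le_trans (Jform_zmx _ z1)); rewrite Jform_pseudo_unitary.
Qed.

(** A kernel vector [w] of the lower right block yields [v = (0, w)] with negative form, while its
    image has zero lower part and hence nonnegative form. The form would have increased, against
    [Jform_twisted]. *)
Lemma det_twisted_neq0 a z k : (forall j, pseudo_unitary (Jmx c d) (a j)) -> normc z <= 1 ->
  \det (drsubmx (twisted_prod a z k)) != 0.
Proof.
move=> aU z1; set T := twisted_prod a z k.
rewrite -det_tr; apply/det0P => -[w w0 wT].
have {wT} Tw : drsubmx T *m w^T = 0 by apply: trmx_inj; rewrite trmx_mul trmxK wT trmx0.
have := Jform_twisted k (col_mx 0 w^T) aU z1; rewrite -/T.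
rewrite -{1}[T]submxK mul_block_col Tw !mulmx0 add0r addr0 /Jform.
rewrite [X in _ - X <= _]big1 => [|i _]; last by rewrite col_mxEd mxE normc0 expr0n.
rewrite [X in _ <= X - _]big1 => [|i _]; last by rewrite col_mxEu mxE normc0 expr0n.
rewrite subr0 sub0r; apply/negP; rewrite -ltNge.
apply: (@lt_le_trans _ _ 0); last by apply: sumr_ge0 => i _; rewrite sqr_ge0.
rewrite oppr_lt0.
have [i wi] : exists i, w 0 i != 0.
  apply/existsP; apply: contraNT w0; rewrite negb_exists => /forallP H.
  by apply/eqP/rowP => i; rewrite mxE; apply/eqP; rewrite -[_ == _]negbK.
rewrite (bigD1 i) //= ltr_pwDl //; last by apply: sumr_ge0 => j _; rewrite sqr_ge0.
by rewrite col_mxEd mxE exprn_gt0 // normc_gt0.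
Qed.

Lemma det_twisted_poly a k : exists p : {poly C}, forall z,
  p.[z] = \det (drsubmx (twisted_prod a z k)).
Proof.
exists (\det (drsubmx (prodmx (fun j => zmx c d 'X *m map_mx polyC (a j)) k))) => z.
rewrite -horner_evalE -det_map_mx map_drsubmx map_prodmx /twisted_prod.
congr (\det (drsubmx _)); elim: k => //= k ->; congr (_ *m _).
rewrite map_mxM map_block_mx !map_mx0 map_mx1 map_scalar_mx /= horner_evalE hornerX.
congr (_ *m _); apply/matrixP => i j; rewrite !mxE.
by rewrite horner_evalE hornerC.
Qed.

Lemma Umx_zmx (t : R) : Umx c d t = zmx c d (expi2pi t). Proof. by []. Qed.

Lemma pseudo_unitary_Umx (t : R) : pseudo_unitary (Jmx c d) (Umx c d t).
Proof.
rewrite /pseudo_unitary /= /Umx adj_block_mx /Jmx !mulmx_block.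
rewrite !(mulmx0, mul0mx, addr0, add0r, trmx0, map_mx0, mulmx1) tr_scalar_mx map_scalar_mx.
rewrite /= -scalar_mxM mulrC conjC_normc normc_expi2pi expr1n.
rewrite ?trmx1 ?map_mx1 ?mul1mx ?mulmxN ?mulmx1 //.
Qed.

Lemma pseudo_unitary1 : pseudo_unitary (Jmx c d) (1%:M : 'M[C]_(c + d)).
Proof. by rewrite /pseudo_unitary /= trmx1 map_mx1 mul1mx mulmx1. Qed.

Lemma pseudo_unitary_twisted a (t : R) k : (forall j, pseudo_unitary (Jmx c d) (a j)) ->
  pseudo_unitary (Jmx c d) (twisted_prod a (expi2pi t) k).
Proof.
move=> aU; elim: k => [|k IH]; first exact: pseudo_unitary1.
by apply: pseudo_unitary_mul => //; apply: pseudo_unitary_mul => //; exact: pseudo_unitary_Umx.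
Qed.

Lemma Rintegral_Nsum_twisted a k : (forall j, pseudo_unitary (Jmx c d) (a j)) ->
  continuous (fun t => Nsum d (twisted_prod a (expi2pi t) k)) /\
  \int[@lebesgue_measure R]_(t in `[0, 1]) Nsum d (twisted_prod a (expi2pi t) k) =
  \sum_(j < k) Nsum d (a j).
Proof.
move=> aU; have [p pE] := det_twisted_poly a k.
have [|cp Ip] := @Rintegral_ln_poly R p.
  by move=> z z1; rewrite pE; exact: det_twisted_neq0.
have E t : Nsum d (twisted_prod a (expi2pi t) k) = ln (normc p.[expi2pi t]).
  by rewrite pE Nsum_ln_det //; exact: pseudo_unitary_twisted.
split; first by under eq_fun do rewrite E.
transitivity (\int[@lebesgue_measure R]_(t in `[0, 1]) ln (normc p.[expi2pi t])).
  by apply: eq_Rintegral => t _; rewrite E.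
rewrite Ip pE (twisted_prod0 a k).2 normc_prod ln_prod => [|j _].
  by apply: eq_bigr => j _; rewrite Nsum_ln_det.
rewrite normc_gt0.
(* The block of a single [a j] has nonzero determinant by the case [z = 1] of a product of length
   one. *)
have n1 : normc (1 : C) <= 1 by rewrite normc1.
have := det_twisted_neq0 1 (fun=> aU j) n1.
by rewrite /twisted_prod /= /zmx -scalar_mx_block mulmx1 mul1mx.
Qed.

End Twisted.

(** * Subadditivity, measurability and integrability *)

Section Fekete.
Context {R : realType}.

(** The limit is the infimum of [b n / n] over [n >= 1]. Nonnegativity provides the lower bound and
    lets one sum dominate all remainder terms. *)
Lemma Fekete (b : nat -> R) : (forall n, 0 <= b n) ->
  (forall m n, b (m + n)%N <= b m + b n) -> cvgn (fun n => b n / n%:R).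
Proof.
move=> b0 bD.
pose S := [set b n.+1 / n.+1%:R | n in [set: nat]].
have S0 : has_inf S.
  split; first by exists (b 1 / 1); exists 0%N.
  by exists 0 => _ [n _ <-]; rewrite divr_ge0.
have bM m q : b (q * m.+1)%N <= b 0%N + q%:R * b m.+1.
  elim: q => [|q IH]; first by rewrite mul0n mul0r addr0.
  rewrite mulSn addnC -natr1 mulrDl mul1r addrA; apply: (le_trans (bD _ _)).
  by rewrite lerD2r.
apply/cvg_ex; exists (inf S) => /=.
apply/cvgrPdist_le => e e0.
have [_ [m _ <-] hm] : exists2 x, S x & x < inf S + e / 2.
  by apply: inf_adherent => //; rewrite divr_gt0.
(* [B] bounds the remainder [b (n mod m+1)] for every [n], together with the term [b 0] left over by
   [bM]. *)
pose B := b 0%N + \sum_(i < m.+1) b i.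
have B0 : 0 <= B by rewrite addr_ge0 // sumr_ge0.
near=> n.
have n0 : (0 < n)%N by near: n; exists 1%N.
have nR : 0 < n%:R :> R by rewrite ltr0n.
have lb : inf S <= b n / n%:R.
  apply: ge_inf; first by case: S0.
  by exists n.-1; rewrite ?prednK.
rewrite distrC ger0_norm ?subr_ge0 // lerBlDl.
have nB : B / n%:R <= e / 2.
  rewrite ler_pdivrMr // mulrC -ler_pdivrMr ?divr_gt0 //.
  have : (Num.bound (B / (e / 2)) <= n)%N by near: n; exists (Num.bound (B / (e / 2))).
  rewrite -(ler_nat R); apply: le_trans; apply/ltW/archi_boundP.
  by rewrite divr_ge0 // divr_ge0 // ltW.
have bn : b n <= B + (n %/ m.+1)%:R * b m.+1.
  rewrite {1}(divn_eq n m.+1); apply: (le_trans (bD _ _)).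
  apply: (le_trans (lerD (bM _ _) (lexx _))); rewrite /B addrAC lerD2r lerD2l.
  rewrite (bigD1 (Ordinal (ltn_pmod n (isT : 0 < m.+1)%N))) //= lerDl.
  by rewrite sumr_ge0.
have : b n / n%:R <= B / n%:R + b m.+1 / m.+1%:R.
  apply: (@le_trans _ _ ((B + (n %/ m.+1)%:R * b m.+1) / n%:R)).
    by rewrite ler_pM2r ?invr_gt0.
  rewrite mulrDl lerD2l mulrAC mulrC ler_wpM2l //.
  rewrite ler_pdivrMr // mulrC ler_pdivlMr ?ltr0n //.
  by rewrite -natrM ler_nat leq_divM.
move: nB hm; move: (B / _) (b m.+1 / _) (b n / _) (inf S) => ? ? ? ? *; lra.
Unshelve. all: by end_near.
Qed.

End Fekete.

Section Measurability.
Context {R : realType} {disp : measure_display} {X : measurableType disp}.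
Local Notation C := R[i].

Definition measurable_cfun (g : X -> C) : Prop :=
  measurable_fun setT (fun x => complex.Re (g x)) /\
  measurable_fun setT (fun x => complex.Im (g x)).

Lemma measurable_cfun_cst z : measurable_cfun (fun=> z).
Proof. by split; exact: measurable_cst. Qed.

Lemma eq_measurable_cfun g h : g =1 h -> measurable_cfun g -> measurable_cfun h.
Proof. by move=> /funext ->. Qed.

Lemma measurable_cfunD g h : measurable_cfun g -> measurable_cfun h ->
  measurable_cfun (fun x => g x + h x).
Proof.
move=> [gr gi] [hr hi]; split.
  rewrite (_ : (fun x => _) = (fun x => complex.Re (g x) + complex.Re (h x))).
    exact: measurable_funD.
  by apply/funext => x; rewrite raddfD.
rewrite (_ : (fun x => _) = (fun x => complex.Im (g x) + complex.Im (h x))).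
  exact: measurable_funD.
by apply/funext => x; rewrite raddfD.
Qed.

Lemma measurable_cfunM g h : measurable_cfun g -> measurable_cfun h ->
  measurable_cfun (fun x => g x * h x).
Proof.
move=> [gr gi] [hr hi]; split.
  rewrite (_ : (fun x => _) = (fun x => complex.Re (g x) * complex.Re (h x)
      - complex.Im (g x) * complex.Im (h x))).
    by apply: measurable_funB; exact: measurable_funM.
  by apply/funext => x; case: (g x) => ? ?; case: (h x).
rewrite (_ : (fun x => _) = (fun x => complex.Re (g x) * complex.Im (h x)
    + complex.Im (g x) * complex.Re (h x))).
  by apply: measurable_funD; exact: measurable_funM.
by apply/funext => x; case: (g x) => ? ?; case: (h x).
Qed.

Lemma measurable_cfun_conj g : measurable_cfun g -> measurable_cfun (fun x => (g x)^*).
Proof.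
move=> [gr gi]; split.
  by rewrite (_ : (fun x => _) = (fun x => complex.Re (g x))) //;
    apply/funext => x; case: (g x).
rewrite (_ : (fun x => _) = (fun x => - complex.Im (g x))).
  exact: measurableT_comp.
by apply/funext => x; case: (g x).
Qed.

Lemma measurable_cfun_sum (I : Type) (r : seq I) (P : pred I) (F : I -> X -> C) :
  (forall i, measurable_cfun (F i)) -> measurable_cfun (fun x => \sum_(i <- r | P i) F i x).
Proof.
move=> mF; elim: r => [|i r IH].
  by under eq_fun do rewrite big_nil; exact: measurable_cfun_cst.
under eq_fun do rewrite big_cons.
by case: (P i) => //; exact: measurable_cfunD.
Qed.

Lemma measurable_cfun_prod (I : Type) (r : seq I) (P : pred I) (F : I -> X -> C) :
  (forall i, measurable_cfun (F i)) -> measurable_cfun (fun x => \prod_(i <- r | P i) F i x).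
Proof.
move=> mF; elim: r => [|i r IH].
  by under eq_fun do rewrite big_nil; exact: measurable_cfun_cst.
under eq_fun do rewrite big_cons.
by case: (P i) => //; exact: measurable_cfunM.
Qed.

Lemma measurable_cfun_det n (T : X -> 'M[C]_n) : measurable_mx T ->
  measurable_cfun (fun x => \det (T x)).
Proof.
move=> mT; apply: measurable_cfun_sum => s; apply: measurable_cfunM.
  exact: measurable_cfun_cst.
by apply: measurable_cfun_prod => i; exact: mT.
Qed.

Lemma measurable_mx_mul n (S T : X -> 'M[C]_n) : measurable_mx S -> measurable_mx T ->
  measurable_mx (fun x => S x *m T x).
Proof.
move=> mS mT i j.
apply: (@eq_measurable_cfun (fun x => \sum_k S x i k * T x k j)).
  by move=> x; rewrite mxE.
by apply: measurable_cfun_sum => k; apply: measurable_cfunM; [exact: mS|exact: mT].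
Qed.

Lemma measurable_mx_cst n (M : 'M[C]_n) : measurable_mx (fun _ : X => M).
Proof. by move=> i j; exact: measurable_cfun_cst. Qed.

Lemma measurable_mx_adj n (T : X -> 'M[C]_n) : measurable_mx T ->
  measurable_mx (fun x => (T x)^t*).
Proof.
move=> mT i j; apply: (@eq_measurable_cfun (fun x => (T x j i)^*)).
  by move=> x; rewrite !mxE.
by apply: measurable_cfun_conj; exact: mT.
Qed.

Lemma measurable_mxX n (T : X -> 'M[C]_n) m : measurable_mx T ->
  measurable_mx (fun x => T x ^+ m).
Proof.
move=> mT; elim: m => [|m IH]; first exact: measurable_mx_cst.
rewrite (_ : (fun x => _) = (fun x => T x *m (T x ^+ m))).
  exact: measurable_mx_mul.
by apply/funext => x; rewrite exprS.
Qed.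

Lemma measurable_minor_sum n k (T : X -> 'M[C]_n) : measurable_mx T ->
  measurable_cfun (fun x => minor_sum k (T x)).
Proof.
move=> mT; apply: measurable_cfun_sum => f; apply: measurable_cfun_det => i j.
apply: (@eq_measurable_cfun (fun x => T x (f i) (f j))); last exact: mT.
by move=> x; rewrite !mxE.
Qed.

(** Singular values are obtained from a choice of roots, so they do not display their measurability.
    The pointwise limit of [ln_sigma_cvg] does, its terms being logarithms of polynomials in the
    entries and their conjugates. *)
Lemma measurable_ln_sigma n k (T : X -> 'M[C]_n) : measurable_mx T ->
  (forall x, T x \in unitmx) -> (k <= n)%N ->
  measurable_fun setT (fun x => ln_sigma k (T x)).
Proof.
move=> mT uT kn.
apply: (measurable_fun_cvg (h := fun m x =>
  ln (complex.Re (minor_sum k (((T x)^t* *m T x) ^+ m.+1))) / (2 * m.+1)%:R)).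
  move=> m; apply: measurable_funM; last exact: measurable_cst.
  apply: measurableT_comp; first exact: measurable_ln.
  have [] // := @measurable_minor_sum n k (fun x => ((T x)^t* *m T x) ^+ m.+1) _.
  apply: measurable_mxX; apply: measurable_mx_mul => //; exact: measurable_mx_adj.
by move=> x _; exact: ln_sigma_cvg.
Qed.

End Measurability.

Section Opnorm.
Context {R : realType}.
Local Notation C := R[i].

Lemma l2normE n (v : 'cV[C]_n) : l2norm v = Num.sqrt (\sum_i normc (v i 0) ^+ 2).
Proof.
by rewrite /l2norm; congr Num.sqrt; apply: eq_bigr => i _; rewrite normrE_normc.
Qed.

Lemma normc_le_l2norm n (v : 'cV[C]_n) i : normc (v i 0) <= l2norm v.
Proof.
rewrite l2normE -[leLHS]ger0_norm ?normc_ge0 // -sqrtr_sqr ler_wsqrtr //.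
by rewrite (bigD1 i) //= lerDl; apply: sumr_ge0 => j _; rewrite sqr_ge0.
Qed.

Lemma normc_le_opnorm n (T : 'M[C]_n) i j : normc (T i j) <= opnorm T.
Proof.
have e1 : l2norm (delta_mx j 0 : 'cV[C]_n) = 1.
  rewrite l2normE (bigD1 j) //= big1 => [|k kj].
    by rewrite mxE !eqxx normc1 expr1n addr0 sqrtr1.
  by rewrite mxE (negPf kj) normc0 expr0n.
have Te : (T *m (delta_mx j 0 : 'cV[C]_n)) i 0 = T i j by rewrite -colE mxE.
rewrite -Te; apply: (le_trans (normc_le_l2norm _ _)).
apply: ub_le_sup; last by exists (delta_mx j 0).
(* An explicit upper bound of the set, without which [sup] would be a default value. *)
exists (Num.sqrt (\sum_i (\sum_j normc (T i j)) ^+ 2)) => _ [v v1 <-].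
rewrite l2normE ler_wsqrtr //; apply: ler_sum => k _.
rewrite lerXn2r ?nnegrE ?normc_ge0 //; first by apply: sumr_ge0 => l _; exact: normc_ge0.
rewrite mxE; apply: (le_trans (ler_normc_sum _ _ _)); apply: ler_sum => l _.
by rewrite normcM ler_piMr ?normc_ge0 // -v1 normc_le_l2norm.
Qed.

Lemma opnorm_gt0 n (T : 'M[C]_n.+1) : T \in unitmx -> 0 < opnorm T.
Proof.
move=> uT; have [j Tj] : exists j, T 0 j != 0.
  apply/existsP; apply: contraLR uT; rewrite negb_exists => /forallP H.
  rewrite unitmxE unitfE negbK (expand_det_row _ 0) big1 // => j _.
  by have := H j; rewrite negbK => /eqP ->; rewrite mul0r.
by apply: lt_le_trans (normc_le_opnorm T 0 j); rewrite normc_gt0.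
Qed.

End Opnorm.

Section MeasurePreserving.
Context {R : realType} {disp : measure_display} {X : measurableType disp}.
Variables (mu : probability X R) (f : X -> X).
Hypothesis fP : measure_preserving mu f.

Lemma measurable_iter j : measurable_fun setT (iter j f).
Proof.
elim: j => [|j IH]; first exact: measurable_id.
by apply: (measurableT_comp fP.1 IH).
Qed.

Lemma integrable_measure_preserving (g : X -> R) : mu.-integrable setT (EFin \o g) ->
  mu.-integrable setT (EFin \o (g \o f)) /\
  \int[mu]_x (g \o f) x = \int[mu]_x g x.
Proof.
move=> ig; have [mf fI] := fP; split; last by rewrite /Rintegral fI.
have mg : measurable_fun setT g by apply/measurable_EFinP; exact: measurable_int ig.
apply/integrableP; split.
  by apply/measurable_EFinP; exact: measurableT_comp.
have := fI (fun x => `|g x|); rewrite /= => ->; last exact: integrable_abse ig.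
by have /integrableP[] := ig.
Qed.

Lemma integrable_iter (g : X -> R) j : mu.-integrable setT (EFin \o g) ->
  mu.-integrable setT (EFin \o (g \o iter j f)) /\
  \int[mu]_x (g \o iter j f) x = \int[mu]_x g x.
Proof.
move=> ig; elim: j => [|j [IH1 IH2]]; first by [].
have [I1 I2] := integrable_measure_preserving IH1.
have E : (g \o iter j f) \o f = g \o iter j.+1 f.
  by apply/funext => x; rewrite /= -iterSr.
by rewrite -E; split => //; rewrite I2.
Qed.

End MeasurePreserving.

Section TonelliStrip.
Context {R : realType} {disp : measure_display} {X : measurableType disp}.
Variable mu : probability X R.
Local Notation leb := (@lebesgue_measure R).
Variable g : R -> X -> R.
Hypothesis mg : measurable_fun setT (fun y : R * X => g y.1 y.2).
Hypothesis g0 : forall t x, 0 <= g t x.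

Let D : set R := `[0%R, 1%R]%classic.
(** The indicator of the unit interval extends the strip to the full product, where Tonelli's
    theorem applies. *)
Let F (y : R * X) := (\1_D y.1 * g y.1 y.2)%:E.

Let F0 y : (0 <= F y)%E.
Proof. by rewrite lee_fin mulr_ge0. Qed.

Let mF : measurable_fun setT F.
Proof.
apply/measurable_EFinP; apply: measurable_funM => //.
apply: (@measurableT_comp _ _ _ _ _ _ (\1_D : R -> R)); last exact: measurable_fst.
by apply: measurable_indic; exact: measurable_itv.
Qed.

Let FE t : (\int[mu]_x F (t, x))%E = ((fun t => \int[mu]_x (g t x)%:E) \_ D)%E t.
Proof.
rewrite patchE /F /= indicE; case: (t \in D) => /=.
  by under eq_integral do rewrite mul1r.
by under eq_integral do rewrite mul0r; rewrite integral0.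
Qed.

Let FE' x : (\int[leb]_t F (t, x))%E = (\int[leb]_(t in D) (g t x)%:E)%E.
Proof.
rewrite [RHS]integral_mkcond; apply: eq_integral => t _.
rewrite patchE /F /= indicE; case: (t \in D) => /=; first by rewrite mul1r.
by rewrite mul0r.
Qed.

Lemma tonelli_strip :
  (\int[leb]_(t in `[0%R, 1%R]) \int[mu]_x (g t x)%:E =
   \int[mu]_x \int[leb]_(t in `[0%R, 1%R]) (g t x)%:E)%E.
Proof.
rewrite integral_mkcond.
transitivity (\int[leb]_t \int[mu]_x F (t, x))%E.
  by apply: eq_integral => t _; rewrite FE.
rewrite (fubini_tonelli (m1 := leb) (m2 := mu) _ mF F0).
by apply: eq_integral => x _; rewrite FE'.
Qed.

Lemma measurable_tonelli_strip :
  measurable_fun setT (fun x => \int[leb]_(t in `[0%R, 1%R]) (g t x)%:E)%E.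
Proof.
have := measurable_fun_fubini_tonelli_G (m1 := leb) _ mF F0.
by apply: eq_measurable_fun => x _; rewrite -FE'.
Qed.

Lemma measurable_tonelli_fiber : measurable_fun setT (fun t => \int[mu]_x (g t x)%:E)%E.
Proof.
have mg' : measurable_fun setT (fun y : R * X => (g y.1 y.2)%:E) by exact/measurable_EFinP.
have h0 (y : R * X) : (0 <= (g y.1 y.2)%:E)%E by rewrite lee_fin.
exact: (measurable_fun_fubini_tonelli_F (m2 := mu) _ mg' h0).
Qed.

End TonelliStrip.

(* These two inequalities are stated over abstract reals because [lra] loops on
   the factorials and powers hidden in [minor_const]. *)
Lemma subadditive_chain (R : realFieldType) (S0 atT at0 t0 bub bu u a iB b nb kp L' : R) : 0 <= L' ->
  t0 <= nb + 10 * L' + S0 -> atT <= at0 + t0 + 2 * L' -> at0 <= bub + a + 2 * L' ->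
  bub <= bu + b + 2 * L' -> bu <= iB + u + 2 * L' -> a <= L' + kp -> u <= L' ->
  iB + b <= nb -> atT <= nb + 10 * L' + S0 + (nb + 10 * L' + kp).
Proof. by move=> *; lra. Qed.

Lemma conj_compare (R : realFieldType) (iB b L N2 sT sM sMB sTB nM nb : R) :
  sT <= sMB + b + L -> sMB <= iB + sM + L -> sM <= sTB + iB + L -> sTB <= b + sT + L ->
  nM <= sM -> sM <= nM + N2 -> iB + b <= nb -> 0 <= N2 ->
  nM - (nb + 2 * L + N2) <= sT <= nM + (nb + 2 * L + N2).
Proof. by move=> *; apply/andP; split; lra. Qed.

Lemma cvgn_EFin (R : realType) (u : nat -> R) (l : R) : u @ \oo --> l ->
  (fun m => (u m)%:E) @ \oo --> l%:E.
Proof. by move=> ul; apply: cvg_EFin => //; exact: nearW. Qed.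

Section RealIntegrable.
Context {R : realType} {disp : measure_display} {X : measurableType disp}.
Variable mu : {measure set X -> \bar R}.
Implicit Types (D : set X) (u v : X -> R).

Lemma integrable_addR D u v : measurable D -> mu.-integrable D (EFin \o u) ->
  mu.-integrable D (EFin \o v) -> mu.-integrable D (EFin \o (fun x => u x + v x)).
Proof. by move=> mD iu iv; exact: (integrableD mD iu iv). Qed.

Lemma integrable_scaleR D (a : R) u : measurable D -> mu.-integrable D (EFin \o u) ->
  mu.-integrable D (EFin \o (fun x => a * u x)).
Proof. by move=> mD iu; exact: (integrableZl mD a iu). Qed.

Lemma EFin_Rintegral D u : measurable D -> mu.-integrable D (EFin \o u) ->
  (\int[mu]_(x in D) (u x)%:E)%E = (\int[mu]_(x in D) u x)%:E.
Proof. by move=> mD iu; rewrite /Rintegral fineK // integrable_fin_num. Qed.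

End RealIntegrable.

Section Majorant.
Context {R : realType} {disp : measure_display} {X : measurableType disp}.
Variables (mu : probability X R) (f : X -> X).
Hypothesis fP : measure_preserving mu f.
Variable phi : X -> R.
Hypothesis iphi : mu.-integrable setT (EFin \o phi).

Lemma integrable_probability_cst (r : R) : mu.-integrable setT (EFin \o (fun=> r)).
Proof. exact: finite_measure_integrable_cst. Qed.

Lemma Rintegral_probability_cst (r : R) : \int[mu]_(x in setT) r = r.
Proof. by rewrite Rintegral_cst //= probability_setT mulr1. Qed.

(** The dominating function for the logarithm of an m-fold product, with one constant and one
    multiple of [phi] per factor. With [K = 0] and [a = 1] it is a Birkhoff sum. *)
Lemma integrable_majorant (K a : R) m :
  mu.-integrable setT (EFin \o (fun x => K + \sum_(j < m) (K + a * phi (iter j f x)))) /\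
  \int[mu]_x (K + \sum_(j < m) (K + a * phi (iter j f x))) = K + m%:R * (K + a * (\int[mu]_x phi x)).
Proof.
have i1 j : mu.-integrable setT (EFin \o (fun x => a * phi (iter j f x))).
  exact/integrable_scaleR/(integrable_iter fP j iphi).1.
have i2 j : mu.-integrable setT (EFin \o (fun x => K + a * phi (iter j f x))).
  by apply: integrable_addR => //; exact: integrable_probability_cst.
have e2 j : \int[mu]_x (K + a * phi (iter j f x)) = K + a * (\int[mu]_x phi x).
  rewrite (@RintegralD _ _ _ mu setT (fun=> K) (fun x => a * phi (iter j f x))) //;
    last exact: integrable_probability_cst.
  have [p1 p2] := integrable_iter fP j iphi.
  have := RintegralZl a measurableT p1 => /= ->.
  by rewrite Rintegral_probability_cst; congr (_ + _ * _); exact: p2.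
elim: m => [|m [IH1 IH2]].
  have -> : (fun x => K + \sum_(j < 0) (K + a * phi (iter j f x))) = (fun=> K).
    by apply/funext => x; rewrite big_ord0 addr0.
  by split; [exact: integrable_probability_cst|rewrite mul0r addr0 Rintegral_probability_cst].
have -> : (fun x => K + \sum_(j < m.+1) (K + a * phi (iter j f x))) =
    (fun x => (K + \sum_(j < m) (K + a * phi (iter j f x))) + (K + a * phi (iter m f x))).
  by apply/funext => x; rewrite big_ord_recr /= addrA.
split; first exact: integrable_addR.
have := RintegralD measurableT IH1 (i2 m) => /= ->.
by rewrite IH2 e2 -natr1 mulrDl mul1r !addrA.
Qed.

Lemma Rintegral_le_shift (u v w : X -> R) (j : nat) (L : R) :
  mu.-integrable setT (EFin \o u) -> mu.-integrable setT (EFin \o v) ->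
  mu.-integrable setT (EFin \o w) ->
  (forall x, w x <= u (iter j f x) + v x + L) ->
  \int[mu]_x w x <= \int[mu]_x u x + \int[mu]_x v x + L.
Proof.
move=> iu iv iw wle; have [iuj <-] := integrable_iter fP j iu.
have i1 := integrable_addR measurableT iuj iv.
have i2 := integrable_addR measurableT i1 (integrable_probability_cst L).
have := le_Rintegral measurableT iw i2 (fun x _ => wle x).
have := RintegralD measurableT i1 (integrable_probability_cst L) => /= ->.
by have := RintegralD measurableT iuj iv => /= ->; rewrite Rintegral_probability_cst.
Qed.

End Majorant.

(** * The averaged cocycle *)

Section Cocycle.
Context {R : realType} {disp : measure_display} {X : measurableType disp}.
Local Notation C := R[i].
Variables (c d : nat) (G B : 'M[C]_(c + d)).
Hypotheses (d_ge1 : (1 <= d)%N) (uB : B \in unitmx) (BG : B^t* *m Jmx c d *m B = G).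
Variables (mu : probability X R) (f : X -> X) (A : X -> 'M[C]_(c + d)).
Hypotheses (fP : measure_preserving mu f) (mA : measurable_mx A)
  (AU : forall x, pseudo_unitary G (A x))
  (iA : mu.-integrable setT (fun x => (ln (opnorm (A x)))%:E)).
Local Notation n := (c + d)%N.
Local Notation leb := (@lebesgue_measure R).

Let A' x := B *m A x *m invmx B.
Let At (t : R) x := invmx B *m Umx c d t *m B *m A x.
Let T t m x := cocycle f (At t) m x.
Let M t m x := twisted_prod (fun j => A' (iter j f x)) (expi2pi t) m.

Lemma pseudo_unitary_conj x : pseudo_unitary (Jmx c d) (A' x).
Proof.
have E : (invmx B)^t* *m G *m invmx B = Jmx c d.
  rewrite -BG !mulmxA -adjmx_mul mulmxV // mulmxK //.
  by rewrite trmx1 map_mx1 mul1mx.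
transitivity ((invmx B)^t* *m ((A x)^t* *m G *m A x) *m invmx B).
  by rewrite /A' !adjmx_mul -BG !mulmxA.
by rewrite AU E.
Qed.

Lemma unitmx_A x : A x \in unitmx.
Proof.
have := pseudo_unitary_unit (pseudo_unitary_conj x).
by rewrite !unitmx_mul => /andP[/andP[_ ->]].
Qed.

Lemma cocycle_twisted t m x : T t m x = invmx B *m M t m x *m B.
Proof.
elim: m => [|m IH]; first by rewrite /T /M /twisted_prod /= mulmx1 mulVmx.
by rewrite /T /= -/(T t m x) IH /M /twisted_prod /= -Umx_zmx /At /A' !mulmxA.
Qed.

Lemma pseudo_unitary_M t m x : pseudo_unitary (Jmx c d) (M t m x).
Proof. by apply: pseudo_unitary_twisted => j; exact: pseudo_unitary_conj. Qed.

Lemma unitmx_T t m x : T t m x \in unitmx.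
Proof.
by rewrite cocycle_twisted !unitmx_mul unitmx_inv uB (pseudo_unitary_unit (pseudo_unitary_M t m x)).
Qed.

Lemma normc_det_T t m x : normc (\det (T t m x)) = 1.
Proof.
rewrite cocycle_twisted !det_mulmx mulrAC -det_mulmx mulVmx // det1 mul1r.
exact: normc_det_pseudo_unitary (pseudo_unitary_M t m x).
Qed.

Lemma cocycleD t m m' x : T t (m + m') x = T t m (iter m' f x) *m T t m' x.
Proof.
elim: m => [|m IH]; first by rewrite add0n /T /= mul1mx.
by rewrite addSn /T /= -/(T t _ _) -/(T t _ _) IH -mulmxA iterD.
Qed.

(** The maps [u] and [g] cover three uses at once: fixed angle, fixed point, and joint measurability
    in both variables. *)
Lemma measurable_cocycle (d' : measure_display) (Y : measurableType d') (u : Y -> R) (g : Y -> X) m :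
  measurable_fun setT u -> measurable_fun setT g ->
  measurable_mx (fun y => T (u y) m (g y)).
Proof.
move=> mu' mg; elim: m => [|m IH]; first exact: measurable_mx_cst.
apply: measurable_mx_mul => //.
apply: measurable_mx_mul; last first.
  move=> i j; have [m1 m2] := mA i j.
  have mi : measurable_fun setT (fun y => iter m f (g y)).
    by apply: (measurableT_comp (measurable_iter fP m) mg).
  by split; [apply: (measurableT_comp m1 mi)|apply: (measurableT_comp m2 mi)].
apply: measurable_mx_mul; last exact: measurable_mx_cst.
apply: measurable_mx_mul; first exact: measurable_mx_cst.
have [cr ci] := @continuous_expi2pi R.
have mE : measurable_cfun (fun y => expi2pi (u y) : C).
  by split; [apply: (measurableT_comp (continuous_measurable_fun cr) mu')|
    apply: (measurableT_comp (continuous_measurable_fun ci) mu')].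
move=> p q; rewrite -[p]splitK -[q]splitK;
  case: (fintype.split p) => i'; case: (fintype.split q) => j' /=;
  rewrite /Umx.
- apply: (@eq_measurable_cfun _ _ _ (fun y => expi2pi (u y) * (i' == j')%:R)).
    by move=> y; rewrite block_mxEul mxE mulr_natr.
  by apply: measurable_cfunM => //; exact: measurable_cfun_cst.
- apply: (@eq_measurable_cfun _ _ _ (fun=> 0)); last exact: measurable_cfun_cst.
  by move=> y; rewrite block_mxEur mxE.
- apply: (@eq_measurable_cfun _ _ _ (fun=> 0)); last exact: measurable_cfun_cst.
  by move=> y; rewrite block_mxEdl mxE.
- apply: (@eq_measurable_cfun _ _ _ (fun=> (1%:M : 'M[C]_d) i' j')); last exact: measurable_cfun_cst.
  by move=> y; rewrite block_mxEdr.
Qed.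

Let phi x := ln (opnorm (A x)).
Let Phi := \int[mu]_x phi x.

Lemma minor_const_ln_ge0 m k : (k <= m)%N -> 0 <= ln (minor_const m k)%:R :> R.
Proof. by move=> km; rewrite ln_ge0 // ler1n minor_const_gt0. Qed.

Lemma ln_sigma_A_le k x : (k <= n)%N ->
  ln_sigma k (A x) <= ln (minor_const n k)%:R + k%:R * phi x.
Proof.
move=> kn; apply: ln_sigma_le => //; first exact: unitmx_A.
  (* In dimension 0 no vector has norm 1 and the supremum is taken over the empty set; [d >= 1]
     exposes the size as a successor. *)
  move: (A x) (unitmx_A x); case: d d_ge1 => // d' _; rewrite addnS => Ax uAx.
  exact: opnorm_gt0.
by move=> i j; exact: normc_le_opnorm.
Qed.

Lemma unitmx_U t : Umx c d t \in @unitmx C n.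
Proof. exact/pseudo_unitary_unit/pseudo_unitary_Umx. Qed.

Lemma ln_sigma_U_le k t : (k <= n)%N ->
  ln_sigma k (Umx c d t : 'M[C]_n) <= ln (minor_const n k)%:R.
Proof.
move=> kn; rewrite -[leRHS]addr0 -(mulr0 k%:R) -(@ln1 R).
apply: ln_sigma_le => //; first exact: unitmx_U.
move=> p q; rewrite -[p]splitK -[q]splitK;
  case: (fintype.split p) => i'; case: (fintype.split q) => j' /=;
  rewrite /Umx.
- by rewrite block_mxEul mxE; case: eqP; rewrite ?mulr1n ?normc_expi2pi ?mulr0n ?normc0.
- by rewrite block_mxEur mxE normc0.
- by rewrite block_mxEdl mxE normc0.
- by rewrite block_mxEdr mxE; case: eqP; rewrite ?normc1 ?normc0.
Qed.

(** Nonnegativity comes from [|det| = 1]. Above, every factor of the cocycle costs a constant plus a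
    multiple of [phi] along the orbit, with [K] uniform in the angle so that dominated convergence
    can use it. *)
Lemma ln_sigma_T_bounds k : (k <= n)%N -> exists2 K : R, 0 <= K & forall t m x,
  0 <= ln_sigma k (T t m x) <= K + \sum_(j < m) (K + k%:R * phi (iter j f x)).
Proof.
move=> kn; set L : R := ln (minor_const n k)%:R.
have L0 : 0 <= L by exact: minor_const_ln_ge0.
(* Appending one factor uses four product inequalities at [2 L] each, and one [L] each for the
   bounds on [A] and on [Umx]: together [10 L]. *)
pose K := `|ln_sigma k (invmx B) + ln_sigma k B| + 10 * L.
have K0 : 0 <= K by rewrite addr_ge0 // mulr_ge0.
exists K => // t m x; rewrite ln_sigma_ge0 ?normc_det_T //=.
elim: m => [|m IH].
  rewrite big_ord0 addr0; apply: (@le_trans _ _ (L + k%:R * ln 1)).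
    apply: ln_sigma_le => //; first exact: unitmx1.
    by move=> i j; rewrite mxE; case: eqP; rewrite ?normc1 ?normc0.
  rewrite ln1 mulr0 addr0 /K -[leLHS]add0r lerD // ler_peMl //.
  by rewrite ler1n.
rewrite /T /= -/(T t m x) big_ord_recr /= addrA.
set y := iter m f x.
have uA := unitmx_A y; have uT := unitmx_T t m x.
have uU := unitmx_U t.
have uiB : invmx B \in unitmx by rewrite unitmx_inv.
have uBU : invmx B *m Umx c d t \in unitmx by rewrite unitmx_mul uiB.
have uBUB : invmx B *m Umx c d t *m B \in unitmx by rewrite unitmx_mul uBU.
have uAt : At t y \in unitmx by rewrite unitmx_mul uBUB.
have h1 := ln_sigma_mul uAt uT kn; rewrite -/L in h1.
have h2 := ln_sigma_mul uBUB uA kn; rewrite -/L -/(At t y) in h2.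
have h3 := ln_sigma_mul uBU uB kn; rewrite -/L in h3.
have h4 := ln_sigma_mul uiB uU kn; rewrite -/L in h4.
have h5 := ln_sigma_A_le y kn; rewrite -/L in h5.
have h6 := ln_sigma_U_le t kn; rewrite -/L in h6.
have h7 : ln_sigma k (invmx B) + ln_sigma k B <= `|ln_sigma k (invmx B) + ln_sigma k B| by exact: ler_norm.
exact: (subadditive_chain L0 IH h1 h2 h3 h4 h5 h6 h7).
Qed.

Lemma integrable_phi : mu.-integrable setT (EFin \o phi). Proof. exact: iA. Qed.

Let V k t m := \int[mu]_x ln_sigma k (T t m x).

Lemma measurable_ln_sigma_T k t m : (k <= n)%N ->
  measurable_fun setT (fun x => ln_sigma k (T t m x)).
Proof.
move=> kn; apply: measurable_ln_sigma => //; last by move=> x; exact: unitmx_T.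
exact: (measurable_cocycle m (@measurable_cst _ _ _ _ _ t) (@measurable_id _ _ _)).
Qed.

Lemma integrable_T k t m : (k <= n)%N ->
  mu.-integrable setT (EFin \o (fun x => ln_sigma k (T t m x))).
Proof.
move=> kn; have [K K0 b] := ln_sigma_T_bounds kn.
apply: (le_integrable _ _ _ (integrable_majorant fP integrable_phi K k%:R m).1) => //.
  by apply/measurable_EFinP; exact: measurable_ln_sigma_T.
move=> x _ /=; rewrite lee_fin; have /andP[b0 b1] := b t m x.
by rewrite !ger0_norm // (le_trans b0).
Qed.

Lemma mean_ln_sigma_bounds k : (k <= n)%N -> exists2 K : R, 0 <= K & forall t m,
  0 <= V k t m <= K + m%:R * (K + k%:R * Phi).
Proof.
move=> kn; have [K K0 b] := ln_sigma_T_bounds kn; exists K => // t m.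
apply/andP; split.
  by apply: Rintegral_ge0 => x _; have /andP[] := b t m x.
rewrite -(integrable_majorant fP integrable_phi K k%:R m).2; apply: le_Rintegral => //.
- exact: integrable_T.
- exact: (integrable_majorant fP integrable_phi _ _ _).1.
- by move=> x _; have /andP[] := b t m x.
Qed.

Lemma mean_ln_sigma_subadditive k t m m' : (k <= n)%N ->
  V k t (m + m') <= V k t m + V k t m' + 2 * ln (minor_const n k)%:R.
Proof.
move=> kn; apply: (@Rintegral_le_shift _ _ _ mu f fP (fun x => ln_sigma k (T t m x))
  (fun x => ln_sigma k (T t m' x)) (fun x => ln_sigma k (T t (m + m') x)) m').
- exact: integrable_T.
- exact: integrable_T.
- exact: integrable_T.
by move=> x; rewrite cocycleD; apply: ln_sigma_mul => //; exact: unitmx_T.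
Qed.

(** Adding the error [L] to the sequence makes it exactly subadditive, and [L / m] tends to 0. *)
Lemma cvg_mean_ln_sigma k t : (k <= n)%N -> cvgn (fun m => V k t m / m%:R).
Proof.
move=> kn; set L : R := 2 * ln (minor_const n k)%:R.
have L0 : 0 <= L by rewrite mulr_ge0 // minor_const_ln_ge0.
have [K _ bV] := mean_ln_sigma_bounds kn.
have c1 : cvgn (fun m => (V k t m + L) / m%:R).
  apply: Fekete => [m|m m'].
    by rewrite addr_ge0 //; have /andP[] := bV t m.
  by rewrite addrACA [X in _ <= X]addrA lerD2r mean_ln_sigma_subadditive.
have c2 : (fun m => L / m%:R) @ \oo --> (0 : R).
  rewrite -(mulr0 L); apply: cvgM; first exact: cvg_cst.
  by rewrite -cvg_shiftS; exact: cvg_harmonic.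
have -> : (fun m => V k t m / m%:R) = (fun m => (V k t m + L) / m%:R - L / m%:R).
  by apply/funext => m; rewrite mulrDl addrK.
by apply: is_cvgB => //; apply/cvg_ex; exists 0.
Qed.

Let dn : (d <= n)%N := leq_addl c d.

(** Conjugation by [B] in either direction changes [ln_sigma] by a bounded amount, and
    [Nsum_ln_sigma] adds at most [d ln 2]. The bound depends on neither the angle, the time nor the
    point. *)
Lemma Nsum_compare : exists2 K : R, 0 <= K & forall t m x,
  Nsum d (M t m x) - K <= ln_sigma d (T t m x) <= Nsum d (M t m x) + K.
Proof.
set L : R := 2 * ln (minor_const n d)%:R.
have L0 : 0 <= L by rewrite mulr_ge0 // minor_const_ln_ge0.
have l2 : 0 <= ln 2 *+ d :> R by rewrite mulrn_wge0 // ln_ge0 // ler1n.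
exists (`|ln_sigma d (invmx B) + ln_sigma d B| + 2 * L + ln 2 *+ d).
  by rewrite !addr_ge0 // mulr_ge0.
move=> t m x; have TE := cocycle_twisted t m x.
have uT := unitmx_T t m x.
have MU := pseudo_unitary_M t m x; have uM := pseudo_unitary_unit MU.
have uiB : invmx B \in unitmx by rewrite unitmx_inv.
have /andP[n1 n2] := Nsum_ln_sigma MU.
have ME : M t m x = B *m T t m x *m invmx B.
  by rewrite TE !mulmxA mulmxV // mul1mx mulmxK.
have uMB : invmx B *m M t m x \in unitmx by rewrite unitmx_mul uiB.
have uTB : B *m T t m x \in unitmx by rewrite unitmx_mul uB.
have h1 := ln_sigma_mul uMB uB dn; rewrite -TE -/L in h1.
have h2 := ln_sigma_mul uiB uM dn; rewrite -/L in h2.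
have h3 := ln_sigma_mul uTB uiB dn; rewrite -ME -/L in h3.
have h4 := ln_sigma_mul uB uT dn; rewrite -/L in h4.
exact: (conj_compare h1 h2 h3 h4 n1 n2 (ler_norm _) l2).
Qed.

Let Nf x := Nsum d (A' x).

Lemma measurable_Nsum : measurable_fun setT Nf.
Proof.
have -> : Nf = (fun x => ln (normc (\det (drsubmx (A' x))))).
  by apply/funext => x; rewrite /Nf Nsum_ln_det //; exact: pseudo_unitary_conj.
apply: measurableT_comp; first exact: measurable_ln.
have [mr mi] : measurable_cfun (fun x => \det (drsubmx (A' x))).
  apply: measurable_cfun_det => p q.
  apply: (@eq_measurable_cfun _ _ _ (fun x => A' x (rshift c p) (rshift c q))).
    by move=> x; rewrite !mxE.
  by apply: measurable_mx_mul; [apply: measurable_mx_mul => //|]; exact: measurable_mx_cst.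
rewrite (_ : (fun x => _) = (fun x => Num.sqrt (complex.Re (\det (drsubmx (A' x))) ^+ 2 +
    complex.Im (\det (drsubmx (A' x))) ^+ 2))); last first.
  by apply/funext => x; case: (\det _).
apply: measurableT_comp.
  by apply: continuous_measurable_fun; exact: sqrt_continuous.
by apply: measurable_funD; apply: measurable_funX.
Qed.

Lemma integrable_Nsum : mu.-integrable setT (EFin \o Nf).
Proof.
set L : R := 2 * ln (minor_const n d)%:R.
pose K := ln_sigma d B + ln_sigma d (invmx B) + 2 * L + ln (minor_const n d)%:R.
have iw : mu.-integrable setT (EFin \o (fun x => K + d%:R * phi x)).
  apply: integrable_addR => //; first exact: integrable_probability_cst.
  exact: integrable_scaleR integrable_phi.
apply: (le_integrable _ _ _ iw) => //; first by apply/measurable_EFinP; exact: measurable_Nsum.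
move=> x _ /=; rewrite lee_fin.
have AU' := pseudo_unitary_conj x.
have N0 : 0 <= Nf x by exact: Nsum_ge0.
rewrite ger0_norm //; apply: le_trans (ler_norm _).
have /andP[le1 _] := Nsum_ln_sigma AU'; apply: (le_trans le1).
have uA := unitmx_A x.
have uiB : invmx B \in unitmx by rewrite unitmx_inv.
have uBA : B *m A x \in unitmx by rewrite unitmx_mul uB.
have h1 := ln_sigma_mul uBA uiB dn; rewrite -/L in h1.
have h2 := ln_sigma_mul uB uA dn; rewrite -/L in h2.
have h3 := ln_sigma_A_le x dn.
apply: (le_trans h1); rewrite /K.
apply: (le_trans (lerD (lerD h2 (lexx _)) (lexx _))).
apply: (le_trans (lerD (lerD (lerD (lerD (lexx _) h3) (lexx _)) (lexx _)) (lexx _))).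
rewrite le_eqVlt; apply/orP; left; apply/eqP.
by move: (ln _) (ln_sigma d B) (ln_sigma d (invmx B)) (_ * phi x) => p q r s; ring.
Qed.

Let N := \int[mu]_x Nf x.
Let S m x := \sum_(j < m) Nf (iter j f x).

Lemma integrable_Birkhoff_Nsum m : mu.-integrable setT (EFin \o S m) /\ \int[mu]_x S m x = m%:R * N.
Proof.
have [i1 i2] := integrable_majorant fP integrable_Nsum 0 1 m.
have E : (fun x => 0 + \sum_(j < m) (0 + 1 * Nf (iter j f x))) = S m.
  by apply/funext => x; rewrite add0r; apply: eq_bigr => j _; rewrite add0r mul1r.
by rewrite E in i1 i2; split => //; rewrite i2 !add0r mul1r.
Qed.

(** [Nsum_compare] averaged over the circle, where the mean of [N_d] is the Birkhoff sum [S m x].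
    The constant is always added, never subtracted, so that both sides remain nonnegative extended
    reals ready for integration over [X]. *)
Lemma circle_mean_ln_sigma_bounds : exists2 K : R, 0 <= K & forall m x,
  ((S m x)%:E <= \int[leb]_(t in `[0%R, 1%R]) (ln_sigma d (T t m x))%:E + K%:E)%E /\
  (\int[leb]_(t in `[0%R, 1%R]) (ln_sigma d (T t m x))%:E <= (S m x + K)%:E)%E.
Proof.
have [K K0 cmp] := Nsum_compare; exists K => // m x.
have [cN iN] : continuous (fun t => Nsum d (M t m x)) /\
    \int[leb]_(t in `[0, 1]) Nsum d (M t m x) = S m x.
  by apply: Rintegral_Nsum_twisted => j; exact: pseudo_unitary_conj.
have i1 := continuous_integrable_itv 0 1 cN.
have icst (r : R) : leb.-integrable `[0%R, 1%R] (EFin \o (fun=> r)).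
  by apply: (@continuous_integrable_itv _ (fun=> r)); exact: cst_continuous.
have i2 : leb.-integrable `[0%R, 1%R] (EFin \o (fun t => Nsum d (M t m x) + K)).
  by apply: integrable_addR => //; exact: icst.
have ig : leb.-integrable `[0%R, 1%R] (EFin \o (fun t => ln_sigma d (T t m x))).
  apply: (le_integrable _ _ _ i2) => //.
    apply/measurable_EFinP; apply: (@measurable_funS _ _ _ _ setT) => //.
    apply: measurable_ln_sigma => //; last by move=> t; exact: unitmx_T.
    exact: (measurable_cocycle m (@measurable_id _ _ _) (@measurable_cst _ _ _ _ _ x)).
  move=> t _ /=; rewrite lee_fin; have /andP[_ b2] := cmp t m x.
  have b0 : 0 <= ln_sigma d (T t m x) by apply: ln_sigma_ge0 => //; exact: normc_det_T.
  by rewrite !ger0_norm // (le_trans b0).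
have i3 : leb.-integrable `[0%R, 1%R] (EFin \o (fun t => ln_sigma d (T t m x) + K)).
  by apply: integrable_addR => //; exact: icst.
rewrite (EFin_Rintegral _ ig) // -EFinD !lee_fin -iN -(Rintegral_unit_cst K).
rewrite -(RintegralD _ ig (icst K)) // -(RintegralD _ i1 (icst K)) //.
split; apply: le_Rintegral => // t _ /=; have /andP[b1 b2] := cmp t m x => //.
by rewrite -lerBlDr.
Qed.

Lemma mean_ln_sigmaE k t m : (k <= n)%N ->
  (\int[mu]_x (ln_sigma k (T t m x))%:E)%E = (V k t m)%:E.
Proof. by move=> kn; rewrite (EFin_Rintegral _ (integrable_T t m kn)). Qed.

Let g m t x := ln_sigma d (T t m x).

Lemma measurable_ln_sigma_prod m : measurable_fun setT (fun y : R * X => g m y.1 y.2).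
Proof.
apply: measurable_ln_sigma => //; last by move=> y; exact: unitmx_T.
exact: (measurable_cocycle m measurable_fst measurable_snd).
Qed.

Lemma ln_sigma_T_ge0 m t x : 0 <= g m t x.
Proof. by apply: ln_sigma_ge0 => //; exact: normc_det_T. Qed.

Lemma measurable_mean_ln_sigma m : measurable_fun setT (fun t => (V d t m)%:E).
Proof.
have := measurable_tonelli_fiber mu (measurable_ln_sigma_prod m) (ln_sigma_T_ge0 m).
by apply: eq_measurable_fun => t _; rewrite mean_ln_sigmaE.
Qed.

Lemma circle_integral_mean_bounds : exists2 K : R, 0 <= K & forall m,
  ((m%:R * N)%:E <= \int[leb]_(t in `[0%R, 1%R]) (V d t m)%:E + K%:E)%E /\
  (\int[leb]_(t in `[0%R, 1%R]) (V d t m)%:E <= (m%:R * N + K)%:E)%E.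
Proof.
have [K K0 b] := circle_mean_ln_sigma_bounds; exists K => // m.
have -> : (\int[leb]_(t in `[0%R, 1%R]) (V d t m)%:E =
    \int[mu]_x \int[leb]_(t in `[0%R, 1%R]) (g m t x)%:E)%E.
  rewrite -(tonelli_strip mu (measurable_ln_sigma_prod m) (ln_sigma_T_ge0 m)).
  by apply: eq_integral => t _; rewrite mean_ln_sigmaE.
have mI := measurable_tonelli_strip (measurable_ln_sigma_prod m) (ln_sigma_T_ge0 m).
have I0 x : (0 <= \int[leb]_(t in `[0%R, 1%R]) (g m t x)%:E)%E.
  by apply: integral_ge0 => t _; rewrite lee_fin ln_sigma_T_ge0.
have [iS IS] := integrable_Birkhoff_Nsum m.
have mS : measurable_fun setT (EFin \o S m) by exact: measurable_int iS.
have S0 x : 0 <= S m x.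
  by apply: sumr_ge0 => j _; apply: Nsum_ge0; exact: pseudo_unitary_conj.
split.
  rewrite -IS -(EFin_Rintegral _ iS) //.
  have -> : K%:E = (\int[mu]_x (cst K%:E) x)%E.
    by rewrite integral_cst //= probability_setT mule1.
  rewrite -ge0_integralD //.
  apply: ge0_le_integral => //.
  - by move=> x _; rewrite lee_fin.
  - exact: emeasurable_funD.
  - by move=> x _; have [] := b m x.
rewrite -IS -(Rintegral_probability_cst mu K) -(RintegralD _ iS (integrable_probability_cst mu K)) //.
have iSK := integrable_addR measurableT iS (integrable_probability_cst mu K).
rewrite -(EFin_Rintegral _ iSK) //.
apply: ge0_le_integral => //.
- exact: measurable_int iSK.
- by move=> x _; have [] := b m x.
Qed.

Let Lk k t := limn (fun m => V k t m / m%:R).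

(** A single [ln sigma_(j+1)] need not be subadditive along the cocycle; it is the difference of two
    consecutive partial sums, each of which has a convergent mean. *)
Lemma lyapunovE j t : (j < n)%N -> lyapunov mu f (At t) j = (Lk j.+1 t - Lk j t)%:E.
Proof.
move=> jn; rewrite /lyapunov; apply: cvg_lim => //.
have E m : ((m%:R^-1)%:E * \int[mu]_x (ln (singular_value (cocycle f (At t) m x) j))%:E)%E =
    (V j.+1 t m / m%:R - V j t m / m%:R)%:E.
  have i1 := integrable_T t m jn; have i0 := integrable_T t m (ltnW jn).
  rewrite -mulrBl mulrC EFinM; congr (_ * _)%E.
  rewrite EFinB -(mean_ln_sigmaE t m jn) -(mean_ln_sigmaE t m (ltnW jn)) -integralB_EFin //.
  apply: eq_integral => x _; rewrite -EFinB; congr EFin.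
  by rewrite /ln_sigma big_ord_recr /= addrAC subrr add0r.
under eq_fun do rewrite E.
apply: cvgn_EFin; apply: cvgB; [exact: cvg_mean_ln_sigma|exact: cvg_mean_ln_sigma (ltnW jn)].
Qed.

Lemma lyapunov_sumE t : lyapunov_sum mu f (At t) d = (Lk d t)%:E.
Proof.
have L0 : Lk 0 t = 0.
  rewrite /Lk (_ : (fun m => _) = (fun=> 0)); first exact: lim_cst.
  apply/funext => m; rewrite /V (_ : (fun x => _) = (fun=> 0)) ?Rintegral_probability_cst ?mul0r //.
  by apply/funext => x; rewrite /ln_sigma big_ord0.
rewrite /lyapunov_sum (eq_bigr (fun j : 'I_d => (Lk j.+1 t - Lk j t)%:E)); last first.
  by move=> j _; apply: lyapunovE; exact: leq_trans (ltn_ord j) dn.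
rewrite sumEFin -(big_mkord xpredT (fun j => Lk j.+1 t - Lk j t)) telescope_sumr //.
by rewrite L0 subr0.
Qed.

Lemma integral_lyapunov_sum :
  (\int[leb]_(t in `[0%R, 1%R]) lyapunov_sum mu f (At t) d = \int[mu]_x (Nf x)%:E)%E.
Proof.
rewrite (EFin_Rintegral _ integrable_Nsum) // -/N.
under eq_integral do rewrite lyapunov_sumE.
have [K K0 bV] := mean_ln_sigma_bounds dn.
have [K' K'0 bI] := circle_integral_mean_bounds.
(* For [m >= 1] the bound on [V] divided by [m] is at most [Q]. For [m = 0] the quotient is 0 by the
   convention on the inverse of 0, and [Q >= 0] follows from the bounds at [m = 1]. *)
pose Q := K + (K + d%:R * Phi).
have V0 t m : 0 <= V d t m by have /andP[] := bV t m.
have Vm t m : V d t m / m%:R <= Q.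
  case: m => [|m].
    by rewrite invr0 mulr0; have /andP[/le_trans H /H] := bV t 1%N; rewrite mul1r.
  rewrite ler_pdivrMr ?ltr0n //; have /andP[_ /le_trans] := bV t m.+1; apply.
  by rewrite /Q mulrDl [(K + _ * _) * _]mulrC lerD2r ler_peMr // ler1n.
pose u m (t : R) := (V d t m / m%:R)%:E.
have mu_ m : measurable_fun setT (u m).
  rewrite /u (_ : (fun t => _) = (fun t => (V d t m)%:E * (m%:R^-1)%:E)%E); last first.
    by apply/funext => t; rewrite EFinM.
  by apply: emeasurable_funM => //; exact: measurable_mean_ln_sigma.
have ul t : u ^~ t @ \oo --> (Lk d t)%:E by apply: cvgn_EFin; exact: cvg_mean_ln_sigma.
have mL : measurable_fun setT (fun t => (Lk d t)%:E).
  by apply: (emeasurable_fun_cvg u) => // t _; exact: ul.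
have iQ : leb.-integrable `[0%R, 1%R] (EFin \o (fun=> Q)).
  by apply: (@continuous_integrable_itv _ (fun=> Q)); exact: cst_continuous.
have [_ _ cJ] : [/\ leb.-integrable `[0%R, 1%R] (fun t => (Lk d t)%:E),
   [sequence (\int[leb]_(t in `[0%R, 1%R]) `|u m t - (Lk d t)%:E|)%E]_m @ \oo --> 0%E &
   [sequence (\int[leb]_(t in `[0%R, 1%R]) u m t)%E]_m @ \oo -->
    (\int[leb]_(t in `[0%R, 1%R]) (Lk d t)%:E)%E].
  apply: (@dominated_convergence _ _ _ leb _ _ u _ (EFin \o (fun=> Q))) => //.
  - by move=> m; apply: measurable_funS (mu_ m).
  - by apply: measurable_funS mL.
  - by apply: aeW => t _; exact: ul.
  - by apply: aeW => t m _; rewrite /u /= lee_fin ger0_norm // divr_ge0.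
(* Dominated convergence gives one limit of the averaged means; the circle identity gives [N] as the
   other, and limits are unique. *)
suff cN : (fun m => (\int[leb]_(t in `[0%R, 1%R]) u m t)%E) @ \oo --> N%:E.
  by apply: (cvg_unique _ cJ cN).
pose J m := (\int[leb]_(t in `[0%R, 1%R]) (V d t m)%:E)%E.
have J0 m : (0 <= J m)%E by apply: integral_ge0 => t _; rewrite lee_fin.
have JE m : J m = (fine (J m))%:E.
  rewrite fineK // ge0_fin_numE //; apply: le_lt_trans (bI m).2 _.
  exact: ltry.
have Jb m : m%:R * N - K' <= fine (J m) <= m%:R * N + K'.
  have [] := bI m; rewrite -/(J m) JE -EFinD !lee_fin => b1 b2.
  by rewrite b2 lerBlDr b1.
have uE m : (\int[leb]_(t in `[0%R, 1%R]) u m t)%E = (fine (J m) / m%:R)%:E.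
  rewrite EFinM -JE muleC -ge0_integralZl //.
  - by apply: eq_integral => t _; rewrite /u mulrC EFinM.
  - by apply: measurable_funS (measurable_mean_ln_sigma m).
  - by move=> t _; rewrite lee_fin.
under eq_fun do rewrite uE.
apply: cvgn_EFin.
have c0 : (fun m => K' / m.+1%:R) @ \oo --> (0 : R).
  by rewrite -(mulr0 K'); apply: cvgM; [exact: cvg_cst|exact: cvg_harmonic].
(* Shifting the index keeps the divisor positive in the squeeze. *)
rewrite -cvg_shiftS.
apply: (@squeeze_cvgr _ _ _ _ (fun m => N - K' / m.+1%:R) (fun m => N + K' / m.+1%:R)).
- apply: nearW => m /=; have m0 : 0 < m.+1%:R :> R by rewrite ltr0n.
  have /andP[b1 b2] := Jb m.+1.
  rewrite ler_pdivlMr // ler_pdivrMr // mulrBl mulrDl divfK ?gt_eqF //.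
  by rewrite mulrC b1 b2.
- by rewrite -[X in _ --> X]subr0; apply: cvgB => //; exact: cvg_cst.
- by rewrite -[X in _ --> X]addr0; apply: cvgD => //; exact: cvg_cst.
Qed.

End Cocycle.

Theorem corollary1p3 (R : realType) (c d : nat) (c_ge1 : (1 <= c)%N)
    (d_ge1 : (1 <= d)%N) (G : 'M[R[i]]_(c + d)) (G_unit : G \in unitmx)
    (G_herm : G \is hermsymmx) (G_sig : has_signature c d G) :
  exists B : 'M[R[i]]_(c + d), B \in unitmx /\
    forall (disp : measure_display) (X : measurableType disp)
      (mu : probability X R) (f : X -> X) (A : X -> 'M[R[i]]_(c + d)),
      measure_preserving mu f ->
      measurable_mx A ->
      (forall x, pseudo_unitary G (A x)) ->
      mu.-integrable setT (fun x => (ln (opnorm (A x)))%:E) ->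
      (\int[lebesgue_measure]_(theta in `[0%R, 1%R])
         lyapunov_sum mu f
           (fun x => invmx B *m Umx c d theta *m B *m A x) d
       = \int[mu]_x (Nsum d (B *m A x *m invmx B))%:E)%E.
Proof.
have [B uB BG] := has_signature_factor G_herm G_sig.
exists B; split => // disp X mu f A fP mA AU iA.
exact: (integral_lyapunov_sum d_ge1 uB BG fP mA AU iA).
Qed.
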